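(* Suppose that $\Lambda_{\mathtt f}$ contains at least one regular $\widetilde W$-orbit, and denote the right action of $\widetilde{\mathbf H}$ on $\mathbf T_{\mathtt f}$ by $\Upsilon$. Then the algebras $\mathbf S_v$ and $\widetilde{\mathbf H}$ satisfy the following double centralizer property: $$\mathbf S_v=\mathrm{End}_{\widetilde{\mathbf H}}(\mathbf T_{\mathtt f}),\qquad \mathrm{End}_{\mathbf S_v}(\mathbf T_{\mathtt f})=\Upsilon(\widetilde{\mathbf H})\cong\widetilde{\mathbf H}.$$
   Context: Let $\Phi$ be a root system with simple roots $\alpha_1,\dots,\alpha_d$, positive roots $\Phi^+$, unique highest root $\theta$, $\theta^\vee=2\theta/(\theta,\theta)$, coweight lattice $\check X$, dominant coweights $\check X^{\mathrm{dom}}=\{\mathbf i\in\check X:\langle\alpha_k,\mathbf i\rangle\in\mathbb N,\ 1\le k\le d\}$, and Weyl group $W=\langle s_1,\dots,s_d\rangle$ generated by the simple reflections. The extended affine Weyl group is $\widetilde W=\check X\rtimes W=\{t_{\mathbf i}w:\mathbf i\in\check X,w\in W\}$ with $t_{\mathbf i}t_{\mathbf j}=t_{\mathbf i+\mathbf j}$, $wt_{\mathbf i}=t_{w(\mathbf i)}w$. Put $s_0=t_{\theta^\vee}s_\theta$ ($s_\theta$ the reflection in $\theta$), $W_{\mathrm{aff}}=\langle s_0,\dots,s_d\rangle$. Then $\widetilde W=\Omega\ltimes W_{\mathrm{aff}}$ with $\Omega$ finite abelian, and $\ell$ is the length function on $\widetilde W$ with $\ell(s_i)=1$ ($0\le i\le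 d$) and $\Omega=\{w:\ell(w)=0\}$. Fix an integer $n\ge2$; $\widetilde W$ acts on $\check X$ from the right by $\mathbf j w=w^{-1}(\mathbf j)$ ($w\in W$), $\mathbf j t_{\mathbf i}=\mathbf j-n\mathbf i$. Let $\mathcal A=\mathbb Z[v,v^{-1}]$. The extended affine Hecke algebra $\widetilde{\mathbf H}$ is the $\mathcal A$-algebra with free basis $\{H_w\}_{w\in\widetilde W}$, $H_wH_{w'}=H_{ww'}$ if $\ell(ww')=\ell(w)+\ell(w')$, and $(H_{s_i}-v^{-1})(H_{s_i}+v)=0$ for $0\le i\le d$. For $\mathbf i\in\check X$ write $\mathbf i=\mathbf j-\mathbf k$ with $\mathbf j,\mathbf k\in\check X^{\mathrm{dom}}$ and put $\theta_{\mathbf i}=H_{t_{\mathbf j}}H_{t_{\mathbf k}}^{-1}$ (independent of the choice). Fix an arbitrary $\widetilde W$-invariant subset $\check X_{\mathtt f}\subset\check X$; $\Lambda_{\mathtt f}$ is the (finite) set of $\widetilde W$-orbits in $\check X_{\mathtt f}$. A $\widetilde W$-orbit is regular if $\widetilde W$ acts simply transitively on it. Let $F=\{\mathbf i\in\check X:-n<\frac{2(\mathbf i,\alpha)}{(\alpha,\alpha)}\le0\ \ \forall\alpha\in\Phi^+\}$, where $F\cap\check X_{\mathtt f}$ is taken as a fundamental domain for $\widetilde W$ acting on $\check X_{\mathtt f}$, and put $F_{\mathtt f}=W(F\cap\check X_{\mathtt f})$. $\mathbf T_{\mathtt f}=\bigoplus_{\mathbf i\in\check X_{\mathtt f}}\mathcal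 A u_{\mathbf i}$ is the free $\mathcal A$-module with basis symbols $u_{\mathbf i}$, with the right $\widetilde{\mathbf H}$-action determined by: for $\mathbf i\in F_{\mathtt f}$ and $1\le k\le d$, $$u_{\mathbf i}H_{s_k}=\begin{cases}v^{-1}u_{\mathbf i},&\mathbf i s_k=\mathbf i,\\ u_{\mathbf i s_k},&\mathbf i s_k\succ\mathbf i,\\ u_{\mathbf i s_k}+(v^{-1}-v)u_{\mathbf i},&\mathbf i s_k\prec\mathbf i,\end{cases}$$ and $u_{\mathbf i}\theta_{\mathbf j}=u_{\mathbf i-n\mathbf j}$ for $\mathbf i\in\check X_{\mathtt f}$, $\mathbf j\in\check X$. Here $\succ$ is the dominance order ($\mathbf i s_k\succ\mathbf i$ means $\langle\alpha_k,\mathbf i\rangle<0$). The affine $q$-Schur algebra is $\mathbf S_v=\mathrm{End}_{\widetilde{\mathbf H}}(\mathbf T_{\mathtt f})$. *)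

(* Defs.v *)
From HB Require Import structures.
From mathcomp Require Import all_boot all_order all_algebra.
From mathcomp Require Import finmap boolp classical_sets reals.
From mathcomp Require Import monalg.

Set Implicit Arguments.
Unset Strict Implicit.
Unset Printing Implicit Defensive.

Import Order.TTheory GRing.Theory Num.Theory.

Local Open Scope classical_set_scope.
Local Open Scope ring_scope.

(** * The ring Z[v, v^-1], as the subring of Z(v) of the fractions p / v^k *)

Section Laurent.

Definition is_laurent : pred {fraction {poly int}} :=
  fun x => `[< exists (p : {poly int}) (k : nat),
    x = FracField.tofrac p / FracField.tofrac 'X ^+ k >].

Lemma is_laurentP x : reflect
  (exists (p : {poly int}) (k : nat),
    x = FracField.tofrac p / FracField.tofrac 'X ^+ k)
  (x \in is_laurent).
Proof. exact: asboolP. Qed.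

Fact fracX_neq0 : FracField.tofrac 'X != 0 :> {fraction {poly int}}.
Proof. by rewrite tofrac_eq0 polyX_eq0. Qed.

Fact laurent_subring_closed : subring_closed is_laurent.
Proof.
have X0 k : FracField.tofrac 'X ^+ k != 0 :> {fraction {poly int}}.
  exact/expf_neq0/fracX_neq0.
split.
- by apply/is_laurentP; exists 1, 0%N; rewrite tofrac1 expr0 divr1.
- move=> _ _ /is_laurentP[p [k ->]] /is_laurentP[q [l ->]]; apply/is_laurentP.
  exists (p * 'X ^+ l - q * 'X ^+ k), (k + l)%N.
  by rewrite tofracB !tofracM !tofracXn exprD -mulNr addf_div ?X0 ?mulNr.
- move=> _ _ /is_laurentP[p [k ->]] /is_laurentP[q [l ->]]; apply/is_laurentP.
  by exists (p * q), (k + l)%N; rewrite tofracM exprD invfM mulrACA.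
Qed.
HB.instance Definition _ :=
  GRing.isSubringClosed.Build {fraction {poly int}} is_laurent
    laurent_subring_closed.

Record laurent : predArgType :=
  Laurent { laurent_val : {fraction {poly int}}; _ : is_laurent laurent_val }.
HB.instance Definition _ := [isSub for laurent_val].
HB.instance Definition _ := [Choice of laurent by <:].
HB.instance Definition _ := [SubChoice_isSubComNzRing of laurent by <:].

Fact laurent_v_subproof : is_laurent (FracField.tofrac 'X).
Proof. by apply/is_laurentP; exists 'X, 0%N; rewrite expr0 divr1. Qed.
Definition lv : laurent := Laurent laurent_v_subproof.

Fact laurent_vV_subproof : is_laurent (FracField.tofrac 'X)^-1.
Proof. by apply/is_laurentP; exists 1, 1%N; rewrite tofrac1 expr1 div1r. Qed.
Definition lvV : laurent := Laurent laurent_vV_subproof.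

Lemma lvVK : lvV * lv = 1.
Proof. by apply: val_inj; rewrite /= mulVf ?fracX_neq0. Qed.

End Laurent.

(** * Free bases, right actions, endomorphism algebras *)

Definition is_basis (A : nzRingType) (K : choiceType) (M : lmodType A)
    (b : K -> M) : Prop :=
  forall x : M, exists! c : {malg A[K]},
    x = \sum_(k <- msupp c) mcoeff k c *: b k.

Section RightAction.
Variables (A : comNzRingType) (H : algType A) (M : lmodType A).
Implicit Types (Ups : H -> {linear M -> M}) (P : set {linear M -> M}).

Definition is_right_action Ups : Prop :=
  [/\ forall m, Ups 1 m = m,
      forall h h' m, Ups (h * h') m = Ups h' (Ups h m) &
      forall (c : A) h h' m, Ups (c *: h + h') m = c *: Ups h m + Ups h' m].

Definition op_image Ups : set {linear M -> M} :=
  [set f : {linear M -> M} | exists h, f =1 Ups h].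

(* The endomorphisms commuting with all operators in P; both endomorphism
   algebras of the double centralizer property are of this form. *)
Definition End_over P : set {linear M -> M} :=
  [set f : {linear M -> M} | forall g, P g -> forall m, f (g m) = g (f m)].

(* [Ups] is an isomorphism of A-algebras from H onto P, where operators in P
   act on the right, so that the product of f and g in P is g \o f. *)
Definition is_right_alg_iso Ups P : Prop :=
  [/\ is_right_action Ups,
      forall h h', Ups h =1 Ups h' -> h = h' &
      P = op_image Ups].

End RightAction.

(** * Root systems *)

Section Reflection.
Variables (R : realType) (V : vectType R) (dotp : {dot V for idfun}).

Definition cartan (x a : V) : R := 2 * dotp x a / dotp a a.

Definition refl (a x : V) : V := x - cartan x a *: a.

Fact refl_is_linear a : linear (refl a).
Proof.
move=> c x y; rewrite /refl /cartan linearDl linearZl_LR /= mulrDr mulrDl.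
rewrite scalerBr scalerA addrACA -opprD -scalerDl.
by congr (_ - (_ + _) *: _); rewrite !mulrA (mulrC c 2).
Qed.
HB.instance Definition _ a :=
  GRing.isLinear.Build R V V *:%R (refl a) (refl_is_linear a).

Definition is_root_system (Phi : seq V) : Prop :=
  [/\ span Phi = fullv,
      0 \notin Phi,
      {in Phi &, forall a b, refl a b \in Phi},
      {in Phi &, forall a b, cartan b a \is a Num.int} &
      {in Phi, forall a c, c *: a \in Phi -> c = 1 \/ c = -1}].

(* [x] is a combination of the [delta k] with coefficients in N. *)
Definition nneg_comb d (delta : d.-tuple V) (x : V) : Prop :=
  exists c : 'I_d -> nat, x = \sum_(k < d) tnth delta k *+ c k.

Definition is_simple_system (Phi : seq V) d (delta : d.-tuple V) : Prop :=
  [/\ basis_of fullv delta,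
      {subset delta <= Phi} &
      {in Phi, forall b, nneg_comb delta b \/ nneg_comb delta (- b)}].

Definition is_highest_root (Phi : seq V) d (delta : d.-tuple V) (th : V) : Prop :=
  th \in Phi /\ {in Phi, forall b, nneg_comb delta (th - b)}.

End Reflection.

(* The existence of a highest root forces the root system to be irreducible.
   The W-invariant inner product [dotp] is not normalised. *)
Record root_datum (R : realType) (V : vectType R) (d : nat) := RootDatum {
  dotp : {dot V for idfun};
  roots : seq V;
  simple : d.-tuple V;
  theta : V;
  rootsP : is_root_system dotp roots;
  simpleP : is_simple_system roots simple;
  thetaP : is_highest_root roots simple theta }.

Section AffineWeyl.
Variables (R : realType) (V : vectType R) (d : nat) (D : root_datum V d).

Definition ip (x y : V) : R := dotp D x y.

Local Notation "'[ x , y ]" := (ip x y).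

Definition pos_root (a : V) : Prop := a \in roots D /\ nneg_comb (simple D) a.

(** Coweights; V is identified with its dual through the inner product, so that
    the pairing of a root a with a coweight x is '[a, x]. *)

Definition is_coweight : pred V :=
  fun x => all (fun a => '[a, x] \is a Num.int) (roots D).

Fact coweight_zmod_closed : zmod_closed is_coweight.
Proof.
split=> [|x y /allP hx /allP hy]; apply/allP=> a ha.
  by rewrite /ip linear0r ?rpred0.
by rewrite /ip linearBr rpredB ?hx ?hy.
Qed.
HB.instance Definition _ :=
  GRing.isZmodClosed.Build V is_coweight coweight_zmod_closed.

Record coweight : predArgType :=
  Coweight { coweight_val :> V; coweightP : is_coweight coweight_val }.
HB.instance Definition _ := [isSub for coweight_val].
HB.instance Definition _ := [Choice of coweight by <:].
HB.instance Definition _ := [SubChoice_isSubZmodule of coweight by <:].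

Definition dominant (x : coweight) : Prop :=
  forall k : 'I_d, '[tnth (simple D) k, x] \is a Num.nat.

Fact coroot_theta_subproof : is_coweight ((2 / '[theta D, theta D]) *: theta D).
Proof.
have [_ _ _ hint _] := rootsP D; have [hth _] := thetaP D.
apply/allP=> a ha; rewrite /ip linearZr_LR /=.
suff -> : 2 / dotp D (theta D) (theta D) * dotp D a (theta D) = cartan (dotp D) a (theta D).
  exact: hint.
by rewrite /cartan mulrAC.
Qed.
Definition coroot_theta : coweight := Coweight coroot_theta_subproof.

(** The finite Weyl group, as a group of linear endomorphisms of V *)

Definition reflV (a : V) : 'End(V) := linfun (refl (dotp D) a).

Definition word (ks : seq 'I_d) : 'End(V) :=
  foldr (fun k f => (reflV (tnth (simple D) k) \o f)%VF) \1%VF ks.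

Definition in_weyl : pred 'End(V) := fun f => `[< exists ks, f = word ks >].

Record weyl : predArgType :=
  Weyl { weyl_lfun :> 'End(V); weylP : in_weyl weyl_lfun }.
HB.instance Definition _ := [isSub for weyl_lfun].
HB.instance Definition _ := [Choice of weyl by <:].

Lemma reflVE a x : reflV a x = refl (dotp D) a x.
Proof. exact: lfunE. Qed.

Fact dotp_sym x y : '[x, y] = '[y, x].
Proof. by rewrite /ip hermitian_subproof /= expr0 mul1r. Qed.

Fact simple_root k : tnth (simple D) k \in roots D.
Proof. by have [_ hs _] := simpleP D; apply/hs/mem_tnth. Qed.

Fact root_norm_neq0 a : a \in roots D -> '[a, a] != 0.
Proof.
move=> ha; rewrite lt0r_neq0 // neq0_dnorm_gt0 //.
by apply: contraTneq ha => ->; have [_ ->] := rootsP D.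
Qed.

Fact reflV_sym a x y : '[reflV a x, y] = '[x, reflV a y].
Proof.
rewrite !reflVE /refl /ip linearBl linearBr linearZl_LR linearZr_LR /=.
congr (_ - _); rewrite /cartan -!/(ip _ _) (dotp_sym y) [in RHS]mulrC.
by rewrite !mulrA [_ * 2]mulrC (mulrAC _ _^-1).
Qed.

Fact reflVV a : a \in roots D -> (reflV a \o reflV a = \1)%VF.
Proof.
move=> ha; apply/lfunP=> x; rewrite comp_lfunE !reflVE id_lfunE {1}/refl.
have -> : cartan (dotp D) (refl (dotp D) a x) a = - cartan (dotp D) x a.
  rewrite {1}/cartan /refl linearBl linearZl_LR /= mulrBr mulrBl -/(cartan _ _ _).
  have h : dotp D a a != 0 := root_norm_neq0 ha.
  by rewrite mulrA mulfK // mulr_natl mulr2n opprD addNKr.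
by rewrite scaleNr opprK /refl subrK.
Qed.

Fact word_cat s1 s2 : word (s1 ++ s2) = (word s1 \o word s2)%VF.
Proof.
by elim: s1 => [|k s IH] /=; rewrite ?comp_lfun1l // IH comp_lfunA.
Qed.

Fact word_rev s : (word (rev s) \o word s = \1)%VF.
Proof.
elim: s => [|k s IH]; first by rewrite comp_lfun1l.
rewrite rev_cons -cats1 word_cat /= comp_lfun1r -comp_lfunA.
by rewrite (comp_lfunA _ _ (word s)) reflVV ?simple_root // comp_lfun1l.
Qed.

Fact weyl1_subproof : in_weyl \1%VF.
Proof. by apply/asboolP; exists [::]. Qed.
Definition weyl1 : weyl := Weyl weyl1_subproof.

Fact weyl_word (f : weyl) : exists ks, f = word ks :> 'End(V).
Proof. exact: (asboolP _ (weylP f)). Qed.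

Fact weyl_mul_subproof (f g : weyl) : in_weyl (f \o g)%VF.
Proof.
have [s ->] := weyl_word f; have [s' ->] := weyl_word g; apply/asboolP.
by exists (s ++ s'); rewrite word_cat.
Qed.
Definition weyl_mul (f g : weyl) : weyl := Weyl (weyl_mul_subproof f g).

Fact weyl_compV (f : weyl) :
  (f^-1 \o f = \1)%VF /\ (f \o f^-1 = \1)%VF.
Proof.
have [s ->] := weyl_word f.
have h1 := word_rev s; have h2 := word_rev (rev s); rewrite revK in h2.
have h : lker (word s) == 0%VS.
  apply/lker0P=> x y e; rewrite -[x](id_lfunE x) -[y](id_lfunE y) -h1.
  by rewrite !comp_lfunE e.
by split; [exact: lker0_compVf | exact: lker0_compfV].
Qed.

Fact weyl_inv_subproof (f : weyl) : in_weyl (f^-1)%VF.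
Proof.
have [h1 h2] := weyl_compV f; have [s e] := weyl_word f.
apply/asboolP; exists (rev s).
by rewrite -[RHS]comp_lfun1r -h2 comp_lfunA e word_rev comp_lfun1l.
Qed.
Definition weyl_inv (f : weyl) : weyl := Weyl (weyl_inv_subproof f).

Fact weyl_mulA : associative weyl_mul.
Proof. by move=> f g h; apply: val_inj; rewrite /= comp_lfunA. Qed.
Fact weyl_mul1g : left_id weyl1 weyl_mul.
Proof. by move=> f; apply: val_inj; rewrite /= comp_lfun1l. Qed.
Fact weyl_mulg1 : right_id weyl1 weyl_mul.
Proof. by move=> f; apply: val_inj; rewrite /= comp_lfun1r. Qed.
Fact weyl_mulVg : left_inverse weyl1 weyl_inv weyl_mul.
Proof. by move=> f; apply: val_inj; have [] := weyl_compV f. Qed.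
Fact weyl_mulgV : right_inverse weyl1 weyl_inv weyl_mul.
Proof. by move=> f; apply: val_inj; have [] := weyl_compV f. Qed.
HB.instance Definition _ := isGroup.Build weyl
  weyl_mulA weyl_mul1g weyl_mulg1 weyl_mulVg weyl_mulgV.

(** The action of the finite Weyl group on coweights *)

Fact weyl_coweight_subproof (w : weyl) (x : coweight) : is_coweight (w (x : V)).
Proof.
have [s ->] := weyl_word w; elim: s => [|k s IH] /=.
  by rewrite id_lfunE coweightP.
apply/allP=> a ha; rewrite comp_lfunE -reflV_sym reflVE.
have [_ _ hr _ _] := rootsP D.
by apply: (allP IH); apply: hr => //; exact: simple_root.
Qed.
Definition weyl_act (w : weyl) (x : coweight) : coweight :=
  Coweight (weyl_coweight_subproof w x).

Fact weyl_act0 w : weyl_act w 0 = 0.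
Proof. by apply: val_inj; rewrite /= linear0. Qed.
Fact weyl_actD w : {morph weyl_act w : x y / x + y}.
Proof. by move=> x y; apply: val_inj; rewrite /= linearD. Qed.
Fact weyl_actN w : {morph weyl_act w : x / - x}.
Proof. by move=> x; apply: val_inj; rewrite /= linearN. Qed.
Fact weyl_act1 x : weyl_act 1%g x = x.
Proof. by apply: val_inj; rewrite /= id_lfunE. Qed.
Fact weyl_actM w w' x : weyl_act (w * w')%g x = weyl_act w (weyl_act w' x).
Proof. by apply: val_inj; rewrite /= comp_lfunE. Qed.

(** The extended affine Weyl group; the pair (i, w) is t_i w *)

Definition ext_weyl : Type := (coweight * weyl)%type.
HB.instance Definition _ := Choice.on ext_weyl.

Definition ext_mul (x y : ext_weyl) : ext_weyl :=
  (x.1 + weyl_act x.2 y.1, (x.2 * y.2)%g).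
Definition ext_one : ext_weyl := (0, 1%g).
Definition ext_inv (x : ext_weyl) : ext_weyl :=
  (- weyl_act (x.2)^-1%g x.1, (x.2)^-1%g).

Fact ext_mulA : associative ext_mul.
Proof.
by move=> x y z; rewrite /ext_mul /= weyl_actM weyl_actD addrA mulgA.
Qed.
Fact ext_mul1g : left_id ext_one ext_mul.
Proof. by case=> i w; rewrite /ext_mul /= weyl_act1 add0r mul1g. Qed.
Fact ext_mulg1 : right_id ext_one ext_mul.
Proof. by case=> i w; rewrite /ext_mul /= weyl_act0 addr0 mulg1. Qed.
Fact ext_mulVg : left_inverse ext_one ext_inv ext_mul.
Proof. by case=> i w; rewrite /ext_mul /ext_inv /= addNr mulVg. Qed.
Fact ext_mulgV : right_inverse ext_one ext_inv ext_mul.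
Proof.
case=> i w; rewrite /ext_mul /ext_inv /= weyl_actN -weyl_actM mulgV.
by rewrite weyl_act1 addrN.
Qed.
HB.instance Definition _ := isGroup.Build ext_weyl
  ext_mulA ext_mul1g ext_mulg1 ext_mulVg ext_mulgV.

Definition transl (i : coweight) : ext_weyl := (i, 1%g).
Definition fin (w : weyl) : ext_weyl := (0, w).

Fact simple_refl_subproof (k : 'I_d) : in_weyl (reflV (tnth (simple D) k)).
Proof. by apply/asboolP; exists [:: k]; rewrite /= comp_lfun1r. Qed.
Definition simple_refl (k : 'I_d) : weyl := Weyl (simple_refl_subproof k).

(* s_theta lies in the group generated by the simple reflections, as does the
   reflection in any root, so the default value 1 of [insubd] is not used. *)
Definition s_theta : weyl := insubd (1%g : weyl) (reflV (theta D)).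

Definition s_aff (k : 'I_d.+1) : ext_weyl :=
  match unlift ord0 k with
  | None => (transl coroot_theta * fin s_theta)%g
  | Some j => fin (simple_refl j)
  end.

(** Length: the elements of length 0 are those permuting the affine simple
    reflections by conjugation, and the length of x is the least m such that
    x = om s_(k_1) ... s_(k_m) with om of length 0.  Such an expression exists
    for every x, so the default value 0 of [xget] is not used. *)

Definition Omega : set ext_weyl :=
  [set om | [set (om * s * om^-1)%g | s in range s_aff] = range s_aff].

Definition has_expr (x : ext_weyl) (m : nat) : Prop :=
  exists (om : ext_weyl) (ks : m.-tuple 'I_d.+1),
    Omega om /\ x = (om * \prod_(k <- ks) s_aff k)%g.

Definition len (x : ext_weyl) : nat :=
  xget 0%N [set m | has_expr x m /\ forall m', has_expr x m' -> (m <= m')%N].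

(** The extended affine Hecke algebra, given with its basis (H_w) *)

Definition is_affine_hecke (H : unitAlgType laurent) (h_ : ext_weyl -> H) : Prop :=
  [/\ is_basis h_,
      forall x y, len (x * y)%g = (len x + len y)%N -> h_ x * h_ y = h_ (x * y)%g &
      forall k, (h_ (s_aff k) - lvV%:A) * (h_ (s_aff k) + lv%:A) = 0].

(* [is_theta h_ i h]: h is theta_i computed from some decomposition of i. *)
Definition is_theta (H : unitAlgType laurent) (h_ : ext_weyl -> H)
    (i : coweight) (h : H) : Prop :=
  exists j k, [/\ dominant j, dominant k, i = j - k &
    h = h_ (transl j) / h_ (transl k)].

(** The right action at level n of the extended affine Weyl group on coweights *)

Definition cw_act (n : nat) (j : coweight) (x : ext_weyl) : coweight :=
  weyl_act (x.2)^-1%g (j - x.1 *+ n).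

Lemma cw_act_transl n j i : cw_act n j (transl i) = j - i *+ n.
Proof. by rewrite /cw_act /= invg1 weyl_act1. Qed.

Lemma cw_act_fin n j w : cw_act n j (fin w) = weyl_act w^-1%g j.
Proof. by rewrite /cw_act /= mul0rn subr0. Qed.

Lemma cw_act1 n j : cw_act n j 1%g = j.
Proof. by rewrite /cw_act /= mul0rn subr0 invg1 weyl_act1. Qed.

Lemma cw_actM n j x y : cw_act n j (x * y)%g = cw_act n (cw_act n j x) y.
Proof.
rewrite /cw_act /= invgM weyl_actM mulrnDl opprD addrA.
congr weyl_act; rewrite [LHS]weyl_actD; congr (_ + _).
rewrite weyl_actN; congr (- _).
by elim: n => [|n IH]; rewrite ?mulr0n ?weyl_act0 // !mulrS weyl_actD IH
  -weyl_actM mulVg weyl_act1.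
Qed.

End AffineWeyl.

(** * The module T_f *)

Record invariant_set (R : realType) (V : vectType R) (d : nat)
    (D : root_datum V d) (n : nat) := InvariantSet {
  inv_pred :> pred (coweight D);
  inv_predP : forall i x, inv_pred i -> inv_pred (cw_act n i x) }.

Section Schur.
Variables (R : realType) (V : vectType R) (d : nat) (D : root_datum V d).
Variables (n : nat) (Xf : invariant_set D n).

Definition Xf_elt : Type := {i : coweight D | Xf i}.
HB.instance Definition _ := Choice.on Xf_elt.

Definition xact (i : Xf_elt) (x : ext_weyl D) : Xf_elt :=
  exist _ (cw_act n (val i) x) (inv_predP x (valP i)).

Definition orbit (i : Xf_elt) : set Xf_elt := range (xact i).

Definition Lambda : set (set Xf_elt) := range orbit.

Definition regular_orbit (O : set Xf_elt) : Prop :=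
  forall i j, O i -> O j -> exists! x : ext_weyl D, xact i x = j.

Definition Fbox : set (coweight D) :=
  [set i : coweight D | forall a : V, pos_root D a ->
     - n%:R < 2 * ip D i a / ip D a a <= 0].

Definition is_fundamental_domain : Prop :=
  forall O, Lambda O -> exists! i, O i /\ Fbox (val i).

Definition Ff : set Xf_elt :=
  [set j : Xf_elt | exists (w : weyl D) (i : Xf_elt),
     Fbox (val i) /\ val j = weyl_act w (val i)].

Definition Tf : Type := {malg laurent[Xf_elt]}.
HB.instance Definition _ := GRing.Lmodule.on Tf.

Definition u_ (i : Xf_elt) : Tf := mkmalgU i 1.

Section Action.
Variables (H : unitAlgType laurent) (h_ : ext_weyl D -> H).

(* i s_k > i for the dominance order means that the pairing of alpha_k with i
   is negative; the value of [xact i (transl j)] is i - n j. *)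
Definition Tf_action_spec (Ups : H -> {linear Tf -> Tf}) : Prop :=
  (forall (i : Xf_elt) (k : 'I_d), Ff i ->
     let s := fin (simple_refl D k) in
     Ups (h_ s) (u_ i) =
       if xact i s == i then lvV *: u_ i
       else if ip D (tnth (simple D) k) (val i) < 0 then u_ (xact i s)
       else u_ (xact i s) + (lvV - lv) *: u_ i) /\
  (forall (i : Xf_elt) (j : coweight D) (h : H), is_theta h_ j h ->
     Ups h (u_ i) = u_ (xact i (transl j))).

Definition schur_algebra (Ups : H -> {linear Tf -> Tf}) : set {linear Tf -> Tf} :=
  End_over (op_image Ups).

End Action.
End Schur.

Arguments Lambda {R V d D n} Xf _.

(* Main.v *)
From Pilot Require Import Defs.
From HB Require Import structures.
From mathcomp Require Import all_boot all_order all_algebra.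
From mathcomp Require Import finmap boolp classical_sets reals.
From mathcomp Require Import monalg.
From mathcomp Require Import zify ring lra.
(* The mathcomp libraries shadow [roots] and [rootsP]. *)
Import Pilot.Defs.

(** Let i0 be the point of a regular orbit in the fundamental domain.  Multiplying
    h on the right by H_(t_k) with k dominant and deep turns it into a combination
    of elements H_(w t_j) = H_w theta_j with w in the finite Weyl group and j
    dominant, and u_(i0) H_w theta_j = u_(i0 w t_j).  As the i0 w t_j are distinct,
    h |-> u_(i0) h is injective, and its image is the span of the regular orbit.
    So the module has a free direct summand of rank one: for each m there is an
    endomorphism of the module that maps u_(i0) h to m h and kills the other
    orbits.  A map f that commutes with all of these satisfies f(u_(i0)) = u_(i0) h0
    for some h0, hence f(m) = m h0 for all m.

    The additivity len (w t_j) = len w + len t_j is obtained by identifying the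
    length with the number of hyperplanes separating the fundamental alcove from
    its image. *)

Set Implicit Arguments.
Unset Strict Implicit.
Unset Printing Implicit Defensive.

Import Order.TTheory GRing.Theory Num.Theory.

Local Open Scope ring_scope.

(** * Roots and the finite Weyl group *)

Section Roots.
Variables (R : realType) (V : vectType R) (d : nat) (D : root_datum V d).
Local Notation "'[ x , y ]" := (ip D x y).
Local Notation Phi := (roots D).
Local Notation al := (tnth (simple D)).
Implicit Types (x y : V) (a b : V) (k : 'I_d) (i j : coweight D) (w : weyl D).

Lemma ipDl x y z : '[x + y, z] = '[x, z] + '[y, z].
Proof. by rewrite /ip linearDl. Qed.
Lemma ipDr x y z : '[z, x + y] = '[z, x] + '[z, y].
Proof. by rewrite /ip linearDr. Qed.
Lemma ipNl x z : '[- x, z] = - '[x, z].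
Proof. by rewrite /ip linearNl. Qed.
Lemma ipNr x z : '[z, - x] = - '[z, x].
Proof. by rewrite /ip linearNr. Qed.
Lemma ipZl c x z : '[c *: x, z] = c * '[x, z].
Proof. by rewrite /ip linearZl_LR. Qed.
Lemma ipZr c x z : '[z, c *: x] = c * '[z, x].
Proof. by rewrite /ip linearZr_LR. Qed.
Lemma ip0l z : '[0, z] = 0.
Proof. by rewrite /ip linear0l. Qed.
Lemma ipMnl x m z : '[x *+ m, z] = '[x, z] *+ m.
Proof. by elim: m => [|m IH]; rewrite ?mulr0n ?ip0l // !mulrS ipDl IH. Qed.
Lemma ipMnr x m z : '[z, x *+ m] = '[z, x] *+ m.
Proof. by rewrite dotp_sym ipMnl dotp_sym. Qed.
Lemma ip_suml (I : Type) (r : seq I) (P : pred I) (F : I -> V) z :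
  '[\sum_(t <- r | P t) F t, z] = \sum_(t <- r | P t) '[F t, z].
Proof. by apply: (big_morph (fun x => '[x, z])) => [x y|]; rewrite ?ipDl ?ip0l. Qed.

Lemma ip_gt0 x : x != 0 -> 0 < '[x, x].
Proof. exact: neq0_dnorm_gt0. Qed.

Lemma root_neq0 a : a \in Phi -> a != 0.
Proof. by move=> ha; apply: contraTneq ha => ->; have [_ ->] := rootsP D. Qed.

Lemma root_gt0 a : a \in Phi -> 0 < '[a, a].
Proof. by move/root_neq0/ip_gt0. Qed.

Definition cart x a : R := cartan (dotp D) x a.

Lemma cartE x a : cart x a = 2 * '[x, a] / '[a, a].
Proof. by []. Qed.

Lemma cart_self a : a \in Phi -> cart a a = 2.
Proof. by move=> ha; rewrite cartE mulfK // root_norm_neq0. Qed.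

Lemma reflE a x : reflV D a x = x - cart x a *: a.
Proof. exact: reflVE. Qed.

Lemma refl_self a : a \in Phi -> reflV D a a = - a.
Proof. by move=> ha; rewrite reflE cart_self // scaler_nat mulr2n opprD addNKr. Qed.

Lemma reflK a : a \in Phi -> involutive (reflV D a).
Proof. by move=> ha x; rewrite -comp_lfunE reflVV ?id_lfunE. Qed.

Lemma refl_root a b : a \in Phi -> b \in Phi -> reflV D a b \in Phi.
Proof. by have [_ _ h _ _] := rootsP D; rewrite reflVE; apply: h. Qed.

Lemma rootN a : (- a \in Phi) = (a \in Phi).
Proof.
have h b : b \in Phi -> - b \in Phi by move=> hb; rewrite -refl_self ?refl_root.
by apply/idP/idP => /h //; rewrite opprK.
Qed.

Lemma cart_int b a : b \in Phi -> a \in Phi -> cart b a \is a Num.int.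
Proof. by have [_ _ _ h _] := rootsP D => hb ha; apply: h. Qed.

Lemma reduced a c : a \in Phi -> c *: a \in Phi -> c = 1 \/ c = -1.
Proof. by have [_ _ _ _ h] := rootsP D => ha; apply: h. Qed.

Lemma ip_reflV a x y : a \in Phi -> '[reflV D a x, reflV D a y] = '[x, y].
Proof. by move=> ha; rewrite reflV_sym reflK. Qed.

Lemma weyl_ind (P : 'End(V) -> Prop) :
  P \1%VF -> (forall k f, P f -> P (reflV D (al k) \o f)%VF) ->
  forall w, P w.
Proof. by move=> h1 hS w; have [s ->] := weyl_word w; elim: s => //= k s;
  apply: hS. Qed.

Lemma ip_weyl w x y : '[w x, w y] = '[x, y].
Proof.
move: x y; elim/weyl_ind: (w : 'End(V)) => [|k f IH] x y; rewrite ?id_lfunE //.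
by rewrite !comp_lfunE ip_reflV // simple_root.
Qed.

Lemma weyl_root w a : a \in Phi -> w a \in Phi.
Proof.
elim/weyl_ind: (w : 'End(V)) a => [|k f IH] a ha; rewrite ?id_lfunE //.
by rewrite comp_lfunE refl_root ?simple_root ?IH.
Qed.

Lemma weylM w w' x : (w * w')%g x = w (w' x).
Proof. by rewrite /= comp_lfunE. Qed.

Lemma weyl1E x : (1%g : weyl D) x = x.
Proof. by rewrite /= id_lfunE. Qed.

Lemma weylN w x : w (- x) = - w x.
Proof. exact: linearN. Qed.

Lemma weylB w x y : w (x - y) = w x - w y.
Proof. exact: linearB. Qed.

Lemma weylZ w c x : w (c *: x) = c *: w x.
Proof. exact: linearZ. Qed.

Lemma weylK w : cancel w (w^-1)%g.
Proof. by move=> x; rewrite -weylM mulVg weyl1E. Qed.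
Lemma weylVK w : cancel (w^-1)%g w.
Proof. by move=> x; rewrite -weylM mulgV weyl1E. Qed.

Lemma ip_weylV w x y : '[(w^-1)%g x, y] = '[x, w y].
Proof. by rewrite -(ip_weyl w) weylVK. Qed.

Lemma simple_free : free (simple D).
Proof. by have [/basis_free] := simpleP D. Qed.

Lemma coord_simple k l : coord (simple D) k (al l) = (k == l)%:R.
Proof. by rewrite (tnth_nth 0) coord_free ?simple_free // eq_sym. Qed.

Lemma coord_nneg k x : nneg_comb (simple D) x -> exists m : nat, coord (simple D) k
  x = m%:R.
Proof.
case=> c ->; exists (c k); rewrite linear_sum (bigD1 k) //= big1 ?addr0 => [|l lk].
  by rewrite linearMn /= coord_simple eqxx.
by rewrite linearMn /= coord_simple eq_sym (negPf lk) mul0rn.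
Qed.

Lemma simple_decomp x : x = \sum_k coord (simple D) k x *: al k.
Proof.
have [hb _ _] := simpleP D.
rewrite {1}(coord_basis hb (memvf x)); apply: eq_bigr => k _.
by rewrite (tnth_nth 0).
Qed.

(** Pairing with the simple roots is an injective linear map from V to R^d, hence onto by dimension.
    The preimage of (1, ..., 1) is integral on every root, each root being up to sign a natural
    combination of simple ones. It is the sum of the fundamental coweights. *)
Lemma rho_exists : exists i : coweight D, forall k, '[al k, i] = 1.
Proof.
pose f (x : V) : 'rV[R]_d := \row_k '[al k, x].
have flin : linear f.
  by move=> c x y; apply/rowP => k; rewrite !mxE ipDr ipZr.
pose fL := GRing.isLinear.Build _ _ _ _ f flin.
pose F : {linear V -> 'rV[R]_d} := HB.pack f fL.
have kerF : lker (linfun F) == 0%VS.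
  apply/lker0P => x y; rewrite !lfunE /= => /rowP e.
  have e0 k : '[al k, x - y] = 0.
    by have := e k; rewrite !mxE ipDr ipNr => ->; rewrite subrr.
  have : '[x - y, x - y] = 0.
    rewrite {1}(simple_decomp (x - y)) ip_suml big1 // => k _.
    by rewrite ipZl e0 mulr0.
  by apply: contra_eq; rewrite -subr_eq0 => /ip_gt0/lt0r_neq0.
have dimV : \dim {:V} = d.
  by have [hb _ _] := simpleP D; rewrite -(size_basis hb).
have imF : limg (linfun F) = fullv.
  apply/eqP; rewrite eqEdim subvf /= limg_dim_eq ?dimV; last first.
    by rewrite (eqP kerF) capv0.
  by rewrite dimvf /dim /= mul1n.
have : (\row_(k < d) 1 : 'rV[R]_d) \in limg (linfun F) by rewrite imF memvf.
case/memv_imgP => x _; rewrite lfunE /= => /rowP e.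
have e1 k : '[al k, x] = 1 by have := e k; rewrite !mxE => <-.
suff hx : is_coweight D x by exists (Coweight hx).
have [_ _ hr] := simpleP D.
have nnegI y : nneg_comb (simple D) y -> '[y, x] \is a Num.int.
  case=> c ->; rewrite ip_suml; apply: rpred_sum => k _.
  by rewrite ipMnl e1 rpred_nat.
apply/allP => a /hr[/nnegI //|/nnegI]; by rewrite ipNl rpredN.
Qed.

Definition rho : coweight D := projT1 (cid rho_exists).
Lemma rhoE k : '[al k, rho] = 1.
Proof. exact: (projT2 (cid rho_exists)). Qed.

(** * Height and positivity of roots *)

Definition height (x : V) : R := '[x, rho].
Definition is_pos (x : V) : bool := 0 < height x.

Lemma htN x : height (- x) = - height x. Proof. exact: ipNl. Qed.
Lemma htD x y : height (x + y) = height x + height y. Proof. exact: ipDl. Qed.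
Lemma htZ c x : height (c *: x) = c * height x. Proof. exact: ipZl. Qed.
Lemma ht_simple k : height (al k) = 1. Proof. exact: rhoE. Qed.
Lemma ht_sum (c : 'I_d -> nat) :
  height (\sum_k al k *+ c k) = (\sum_k c k)%:R.
Proof.
by rewrite /height ip_suml natr_sum; apply: eq_bigr => k _; rewrite ipMnl rhoE.
Qed.

Lemma root_int a i : a \in Phi -> '[a, i] \is a Num.int.
Proof. by move=> ha; apply: (allP (coweightP i)). Qed.

Lemma nneg_ht_ge0 x : nneg_comb (simple D) x -> 0 <= height x.
Proof. by case=> c ->; rewrite ht_sum ler0n. Qed.

Lemma nneg_ht0 x : nneg_comb (simple D) x -> height x = 0 -> x = 0.
Proof.
case=> c ->; rewrite ht_sum => /eqP; rewrite pnatr_eq0 sum_nat_eq0 => /forallP h.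
by rewrite big1 // => k _; rewrite (eqP (h k)).
Qed.

Lemma root_nneg a : a \in Phi -> is_pos a -> nneg_comb (simple D) a.
Proof.
move=> ha p; have [_ _ hr] := simpleP D; case: (hr _ ha) => // /nneg_ht_ge0.
by rewrite htN; move: p; rewrite /is_pos; lra.
Qed.

Lemma pos_rootE a : pos_root D a <-> a \in Phi /\ is_pos a.
Proof.
split=> -[ha h]; split=> //; last exact: root_nneg.
rewrite /is_pos lt_def nneg_ht_ge0 // andbT.
by apply: contraNneq (root_neq0 ha) => /(nneg_ht0 h) ->.
Qed.

Lemma posN a : a \in Phi -> is_pos (- a) = ~~ is_pos a.
Proof.
move=> ha; have : is_pos a \/ is_pos (- a).
  have [_ _ hr] := simpleP D; have [h|h] := hr _ ha; [left|right].
    by have [] := (pos_rootE a).1 (conj ha h).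
  by have [] := (pos_rootE (- a)).1 (conj (etrans (rootN a) ha) h).
by rewrite /is_pos htN; lra.
Qed.

Lemma ht_int a : a \in Phi -> height a \is a Num.int.
Proof. exact: root_int. Qed.

Lemma pos_simple k : is_pos (al k).
Proof. by rewrite /is_pos ht_simple. Qed.

(** The reflection changes only the coordinate at [al k]. If it made [a] negative, all other
    coordinates of [a] would vanish, and [a] would be [al k] or its opposite since the root system
    is reduced. *)
Lemma simple_refl_pos k a : a \in Phi -> is_pos a -> a != al k ->
  is_pos (reflV D (al k) a).
Proof.
move=> ha pa nak; apply: contraT; set b := reflV _ _ a => nb.
have hb : b \in Phi by rewrite refl_root ?simple_root.
have nnb : nneg_comb (simple D) (- b) by apply: root_nneg; rewrite ?rootN ?posN.
have nna := root_nneg ha pa.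
have c0 l : l != k -> coord (simple D) l a = 0.
  move=> lk; have [m em] := coord_nneg l nna; have [m' em'] := coord_nneg l nnb.
  move: em'; rewrite /b reflE linearN linearB linearZ /= coord_simple (negPf lk)
    mulr0 subr0.
  rewrite em => /eqP; rewrite eq_sym -subr_eq0 opprK -natrD pnatr_eq0 addn_eq0.
  by case/andP=> _ /eqP ->.
have ea : a = coord (simple D) k a *: al k.
  rewrite {1}(simple_decomp a) (bigD1 k) //= big1 ?addr0 // => l lk.
  by rewrite c0 ?scale0r.
have [e|e] := @reduced (al k) (coord (simple D) k a) (simple_root D k) (eq_ind _
  (fun z => z \in Phi) ha _ ea).
  by move: nak; rewrite ea e scale1r eqxx.
by move: pa; rewrite /is_pos ea e htZ ht_simple; lra.
Qed.

(** * The highest root *)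

Local Notation th := (theta D).

Lemma theta_root : th \in Phi. Proof. by have [] := thetaP D. Qed.
Lemma theta_nneg b : b \in Phi -> nneg_comb (simple D) (th - b).
Proof. by have [_] := thetaP D; apply. Qed.

Lemma theta_ht b : b \in Phi -> height b <= height th.
Proof. by move/theta_nneg/nneg_ht_ge0; rewrite htD htN subr_ge0. Qed.

Lemma theta_pos : is_pos th.
Proof.
have /theta_ht := etrans (rootN th) theta_root; rewrite htN => h.
have : ~~ is_pos th -> False; last by case: (is_pos th) => // /(_ isT).
by rewrite -posN ?theta_root // /is_pos htN; move: h; lra.
Qed.

(** The reflection of theta in [al k] is a root, so theta minus it, a multiple of [al k], has
    nonnegative height. *)
Lemma theta_dominant k : 0 <= '[al k, th].
Proof.
have hr := refl_root (simple_root D k) theta_root.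
have := nneg_ht_ge0 (theta_nneg hr).
rewrite reflE opprB addrCA subrr addr0 htZ ht_simple mulr1 cartE dotp_sym.
by rewrite pmulr_lge0 ?invr_gt0 ?root_gt0 ?simple_root // pmulr_rge0.
Qed.

Lemma theta_ip_ge0 a : a \in Phi -> is_pos a -> 0 <= '[a, th].
Proof.
move=> ha /(root_nneg ha)[c ->]; rewrite ip_suml sumr_ge0 // => k _.
by rewrite ipMnl mulrn_wge0 ?theta_dominant.
Qed.

(** Dominance of theta makes this a natural number. If it were at least 2, comparing the heights of
    the roots [a] and [- reflV D th a] with the maximal height would force [a] to be theta. *)
Lemma theta_cart a : a \in Phi -> is_pos a -> a != th ->
  cart a th = 0 \/ cart a th = 1.
Proof.
move=> ha pa ath; have ci := cart_int ha theta_root.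
have c0 : 0 <= cart a th.
  by rewrite cartE mulr_ge0 ?invr_ge0 ?(ltW (root_gt0 theta_root)) // mulr_ge0
    ?theta_ip_ge0.
have [m em] : exists m : nat, cart a th = m%:R.
  by have := @natrEint R (cart a th); rewrite ci c0 => /natrP[m em]; exists m.
case: m em => [|[|m]] em; [by left|by right|exfalso].
have hr := refl_root theta_root ha.
have n1 : nneg_comb (simple D) (th - a) := theta_nneg ha.
have n2 : nneg_comb (simple D) (th - - reflV D th a) by apply: theta_nneg;
  rewrite rootN.
have [[h1 h2] hp] := (nneg_ht_ge0 n1, nneg_ht_ge0 n2, theta_pos).
have hm : 0 <= m%:R * height th by rewrite mulr_ge0 // ltW.
have z : height (th - a) = 0.
  move: h1 h2; rewrite !htD !htN opprK reflE htD htN htZ em -addn2 natrD.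
  by move: hp hm; rewrite /is_pos; nra.
by move: ath; rewrite eq_sym -subr_eq0 (nneg_ht0 n1 z) eqxx.
Qed.

Lemma refl_conj a b x : a \in Phi -> b \in Phi ->
  reflV D (reflV D a b) x = reflV D a (reflV D b (reflV D a x)).
Proof.
move=> ha hb; rewrite [LHS]reflE (reflE b) (linearB (reflV D a)) [X in _ = _ -
  X]linearZ /= reflK //.
suff -> : cart x (reflV D a b) = cart (reflV D a x) b by [].
by rewrite !cartE ip_reflV // reflV_sym.
Qed.

(** Induction on the height. As [a] has positive norm, some simple root pairs positively with it;
    reflecting [a] in that root gives a positive root of smaller height, whose reflection is
    conjugate to that of [a]. It follows that [s_theta] is a true reflection and not the default
    value. *)
Lemma pos_root_refl_weyl a : a \in Phi -> is_pos a -> in_weyl D (reflV D a).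
Proof.
move=> ha pa; have [m hm] : exists m : nat, height a = m%:R.
  have := @natrEint R (height a); rewrite ht_int // (ltW pa) => /natrP[m em].
  by exists m.
elim/ltn_ind: m a ha pa hm => m IH a ha pa hm.
have [k hk] : exists k, 0 < '[al k, a].
  apply: contrapT => h; have := root_gt0 ha; apply/negP; rewrite -leNgt.
  have [c ec] := root_nneg ha pa; rewrite {1}ec ip_suml sumr_le0 // => k _.
  rewrite ipMnl mulrn_wle0 // leNgt; apply/negP => hk; apply: h; by exists k.
have [->|nak] := eqVneq a (al k); first by rewrite simple_refl_subproof.
set b := reflV D (al k) a.
have hb : b \in Phi by rewrite refl_root ?simple_root.
have pb : is_pos b by apply: simple_refl_pos.
have hc : 0 < cart a (al k).
  by rewrite cartE divr_gt0 ?root_gt0 ?simple_root // mulr_gt0 // dotp_sym.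
have [m' em'] : exists m' : nat, height b = m'%:R.
  have := @natrEint R (height b); rewrite ht_int // (ltW pb) => /natrP[m' em'].
  by exists m'.
have lt : (m' < m)%N.
  by rewrite -(ltr_nat R) -em' -hm /b reflE htD htN htZ ht_simple; lra.
have := IH m' lt b hb pb em' => ib.
have -> : reflV D a = (simple_refl D k * Weyl ib * simple_refl D k)%g :> 'End(V).
  apply/lfunP => x; rewrite !weylM /= -refl_conj ?simple_root //.
  by rewrite /b reflK ?simple_root.
exact: weylP.
Qed.

Lemma s_thetaE : s_theta D = reflV D th :> 'End(V).
Proof. by rewrite /s_theta val_insubd pos_root_refl_weyl ?theta_root ?theta_pos. Qed.

End Roots.

(** * The length function *)

Section Length.
Variables (R : realType) (V : vectType R) (d : nat) (D : root_datum V d).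
Local Notation "'[ x , y ]" := (ip D x y).
Local Notation Phi := (roots D).
Local Notation al := (tnth (simple D)).
Local Notation th := (theta D).
Local Notation ht := (height D).
Local Notation pos := (is_pos D).
Implicit Types (a b : V) (k : 'I_d.+1) (i j : coweight D) (w : weyl D).
Implicit Types (x y : ext_weyl D).

(* The affine root [a + m] is positive on the fundamental alcove iff [eps a <= m]. *)
Definition eps a : int := if pos a then 0 else 1.
Definition pairing a i : int := Num.floor '[a, i].

Lemma pairingE a i : a \in Phi -> (pairing a i)%:~R = '[a, i].
Proof. by move=> ha; apply/eqP; rewrite -intrEfloor root_int. Qed.

Lemma pairingD a i j : a \in Phi -> pairing a (i + j) = pairing a i + pairing a j.
Proof.
by move=> ha; apply/(@intr_inj R); rewrite rmorphD /= !pairingE //= -ipDr.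
Qed.

Lemma pairingNr a i : a \in Phi -> pairing a (- i) = - pairing a i.
Proof.
by move=> ha; apply/(@intr_inj R); rewrite rmorphN /= !pairingE //= ipNr.
Qed.

Lemma pairingNl a i : a \in Phi -> pairing (- a) i = - pairing a i.
Proof.
by move=> ha; apply/(@intr_inj R); rewrite rmorphN /= !pairingE ?rootN //= ipNl.
Qed.

Lemma pairing_weyl a w i : pairing a (weyl_act w i) = pairing ((w^-1)%g a) i.
Proof. by rewrite /pairing /weyl_act /= -ip_weylV. Qed.

Lemma epsN a : a \in Phi -> eps (- a) = 1 - eps a.
Proof. by move=> ha; rewrite /eps posN //; case: (pos a). Qed.

(* [`|sep x a|] is the number of hyperplanes orthogonal to [a] that separate the
   fundamental alcove A from x A; it is a cocycle in [x], see [sepM]. *)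
Definition sep x a : int := eps ((x.2)^-1%g a) - pairing a x.1 - eps a.

Lemma sepM x y a : a \in Phi ->
  sep (x * y)%g a = sep x a + sep y ((x.2)^-1%g a).
Proof.
move=> ha; rewrite /sep -[(x * y)%g.1]/(x.1 + weyl_act x.2 y.1).
rewrite -[(x * y)%g.2]/(x.2 * y.2)%g invgM weylM pairingD // pairing_weyl. ring.
Qed.

Lemma sepN x a : a \in Phi -> sep x (- a) = - sep x a.
Proof.
by move=> ha; rewrite /sep weylN pairingNl // !epsN ?weyl_root //; lia.
Qed.

Lemma pairing0 a : pairing a 0 = 0.
Proof. by rewrite /pairing -[X in '[_, X]](mulr0n (0 : V)) ipMnr mulr0n floor0. Qed.

Lemma sep_fin w a : sep (fin w) a = eps ((w^-1)%g a) - eps a.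
Proof. by rewrite /sep pairing0 subr0. Qed.

Lemma sep_transl i a : sep (transl i) a = - pairing a i.
Proof. by rewrite /sep invg1 weyl1E addrAC subrr sub0r. Qed.

Lemma sep1 a : sep 1%g a = 0.
Proof. by rewrite -[1%g]/(fin 1%g) sep_fin invg1 weyl1E subrr. Qed.

Lemma sepV x a : a \in Phi -> sep x^-1%g a = - sep x (x.2 a).
Proof.
move=> ha; apply/eqP; rewrite eq_sym -subr_eq0 -opprD oppr_eq0; apply/eqP.
by rewrite -(sep1 (x.2 a)) -(mulgV x) sepM ?weyl_root // weylK.
Qed.

(* Twice the length: a separating hyperplane is counted for [a] and for [- a]. *)
Definition dlen x : nat := \sum_(a <- undup Phi) `|sep x a|%N.

Lemma big_root_weyl w (F : V -> nat) :
  (\sum_(a <- undup Phi) F (w a) = \sum_(a <- undup Phi) F a)%N.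
Proof.
rewrite -(big_map (w : V -> V) xpredT F); apply: perm_big.
have wI := can_inj (weylK w).
apply: uniq_perm; rewrite ?map_inj_uniq ?undup_uniq // => a.
apply/mapP/idP => [[b + ->]|]; rewrite !mem_undup => ha; first exact: weyl_root.
exists ((w^-1)%g a); last by rewrite weylVK.
by rewrite mem_undup weyl_root.
Qed.

Lemma dlenV x : dlen x^-1%g = dlen x.
Proof.
rewrite /dlen -[RHS](big_root_weyl x.2); apply: eq_big_seq => a.
by rewrite mem_undup => ha; rewrite sepV // abszN.
Qed.

Lemma dlenM_le x y : (dlen (x * y)%g <= dlen x + dlen y)%N.
Proof.
rewrite /dlen -[X in (_ <= _ + X)%N](big_root_weyl (x.2)^-1%g) -big_split /=.
rewrite big_seq [leqRHS]big_seq; apply: leq_sum => a; rewrite mem_undup => ha.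
by rewrite sepM //; move: (sep x a) (sep y _) => p q; lia.
Qed.

(** The two cocycle terms never have opposite signs, so their absolute values add without
    cancellation. *)
Lemma dlenM x y :
  (forall a, a \in Phi -> 0 <= sep x a * sep y ((x.2)^-1%g a)) ->
  dlen (x * y)%g = (dlen x + dlen y)%N.
Proof.
move=> h; rewrite /dlen -[X in (_ + X)%N](big_root_weyl (x.2)^-1%g) -big_split /=.
apply: eq_big_seq => a; rewrite mem_undup => ha.
by rewrite sepM //; move: (sep x a) (sep y _) (h a ha) => p q; nia.
Qed.

Lemma dlen_eq0 x : dlen x = 0%N <-> forall a, a \in Phi -> sep x a = 0.
Proof.
split=> [/eqP|h]; last first.
  by rewrite /dlen big_seq big1 // => a; rewrite mem_undup => /h ->.
rewrite /dlen sum_nat_seq_eq0 => /allP h a ha; apply/eqP.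
by have := h a; rewrite mem_undup ha absz_eq0 => /(_ isT).
Qed.

(** The linear parts of the affine simple roots; index 0 stands for 1 - theta. *)
Definition aroot k : V := if unlift ord0 k is Some l then al l else - th.

Lemma aroot0 : aroot ord0 = - th.
Proof. by rewrite /aroot unlift_none. Qed.
Lemma arootS l : aroot (lift ord0 l) = al l.
Proof. by rewrite /aroot liftK. Qed.
Lemma s_aff0 : s_aff D ord0 = (coroot_theta D, s_theta D).
Proof.
rewrite /s_aff unlift_none; congr (_, _); last exact: mul1g.
by rewrite [weyl_act _ _]weyl_act0 addr0.
Qed.
Lemma s_affS l : s_aff D (lift ord0 l) = fin (simple_refl D l).
Proof. by rewrite /s_aff liftK. Qed.

Lemma aroot_root k : aroot k \in Phi.
Proof.
by case: (unliftP ord0 k) => [l|] ->;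
  rewrite ?arootS ?aroot0 ?rootN ?simple_root ?theta_root.
Qed.

Lemma reflVN a v : reflV D (- a) v = reflV D a v.
Proof.
rewrite !reflE scalerN opprK !cartE !ipNr ipNl opprK mulrN mulNr scaleNr.
by [].
Qed.

Lemma s_aff_lin k v : (s_aff D k).2 v = reflV D (aroot k) v.
Proof.
case: (unliftP ord0 k) => [l|] ->; first by rewrite s_affS arootS.
by rewrite s_aff0 aroot0 reflVN /= s_thetaE.
Qed.

Lemma s_affK k : (s_aff D k * s_aff D k)%g = 1%g.
Proof.
have sqS a (ha : a \in Phi) (ia : in_weyl D (reflV D a)) : (Weyl ia * Weyl ia = 1)%g.
  by apply: val_inj; rewrite /= reflVV.
case: (unliftP ord0 k) => [l|] ->.
  rewrite s_affS; congr (_, _); last exact: sqS (simple_root D l) _.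
  by rewrite /= weyl_act0 addr0.
have e2 v : s_theta D v = reflV D th v by rewrite s_thetaE.
rewrite s_aff0; congr (_, _).
  apply: val_inj; rewrite /= e2 linearZ /= refl_self ?theta_root //.
  by rewrite scalerN addrN.
apply: val_inj; apply/lfunP => v; rewrite /= !comp_lfunE !id_lfunE.
by rewrite !e2 reflK ?theta_root.
Qed.

Lemma s_affV k : (s_aff D k)^-1%g = s_aff D k.
Proof. by apply: (mulgI (s_aff D k)); rewrite mulgV s_affK. Qed.

Lemma s_aff_linV k v : ((s_aff D k).2)^-1%g v = reflV D (aroot k) v.
Proof. by rewrite -s_aff_lin -{2}(s_affV k). Qed.

(** A simple reflection crosses no hyperplane but its own wall. In the finite case this is
    [simple_refl_pos]; for index 0 it rests on [theta_cart]. *)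
Lemma sep_aff_other k b : b \in Phi -> b != aroot k -> b != - aroot k ->
  sep (s_aff D k) b = 0.
Proof.
move=> hb; wlog pb : b hb / pos b => [IH|].
  case: (boolP (pos b)) => pb h1 h2; first exact: IH.
  rewrite -[b]opprK sepN ?rootN // IH ?oppr0 ?rootN ?posN //.
    by rewrite eqr_oppLR.
  by rewrite eqr_opp.
rewrite /sep s_aff_linV; case: (unliftP ord0 k) => [l|] -> {k}.
  rewrite arootS s_affS /= pairing0 => h1 _.
  by rewrite /eps simple_refl_pos // pb.
rewrite aroot0 opprK reflVN s_aff0 => _ h2.
have e : pairing b (coroot_theta D) = Num.floor (cart D b th).
  rewrite /pairing /= ipZr; congr Num.floor.
  by rewrite cartE mulrAC.
rewrite [pairing _ _]e reflE; have [->|->] := theta_cart hb pb h2.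
  by rewrite scale0r subr0 floor0 subr0 subrr.
(* When the Cartan number is 1, [b - th] has height at most 0, so its [eps] is 1 and cancels the
   pairing. *)
rewrite scale1r floor1 /eps pb.
case: ifP => // pp; exfalso; have /theta_ht := hb.
by move: pp; rewrite /pos /is_pos htD htN; lra.
Qed.

Lemma sep_aff_self k : sep (s_aff D k) (aroot k) = 1.
Proof.
rewrite /sep s_aff_linV refl_self ?aroot_root // epsN ?aroot_root //.
case: (unliftP ord0 k) => [l|] -> {k}.
  by rewrite arootS s_affS /= pairing0 /eps pos_simple.
rewrite aroot0 s_aff0 pairingNl ?theta_root // epsN ?theta_root // /eps theta_pos.
rewrite /pairing /= ipZr -/(ip D th th) divfK ?root_norm_neq0 ?theta_root //.
by rewrite (intrKfloor 2).
Qed.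

Lemma rootN_neq a : a \in Phi -> - a != a.
Proof. by move=> ha; rewrite -subr_eq0 -opprD oppr_eq0 -mulr2n -scaler_nat
  scaler_eq0 pnatr_eq0 /= (root_neq0 ha). Qed.

Lemma sep_affE k b : b \in Phi ->
  sep (s_aff D k) b = (b == aroot k)%:Z - (b == - aroot k)%:Z.
Proof.
move=> hb; have hk := aroot_root k.
have [->|h1] := eqVneq b (aroot k).
  by rewrite sep_aff_self eq_sym (negPf (rootN_neq hk)).
have [->|h2] := eqVneq b (- aroot k); first by rewrite sepN // sep_aff_self.
by rewrite sep_aff_other.
Qed.

Lemma big_root_pm (F : V -> nat) a : a \in Phi ->
  (\sum_(b <- undup Phi) F b = F a + (F (- a)%R +
     \sum_(b <- undup Phi | (b != a) && (b != - a)%R) F b))%N.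
Proof.
move=> ha; rewrite (bigD1_seq a) ?undup_uniq ?mem_undup //=; congr (_ + _)%N.
rewrite -big_filter (bigD1_seq (- a)) ?filter_uniq ?undup_uniq //=.
  by rewrite big_filter_cond.
by rewrite mem_filter mem_undup rootN ha rootN_neq.
Qed.

(** Left multiplication by the reflection permutes the values of [sep x], except that the value at
    its own wall drops by one. That wall is counted for two opposite roots, hence the 2; in the
    first case the subtraction does not truncate, by [dlen_s_ge]. *)
Lemma dlen_s k x : dlen (s_aff D k * x)%g =
  if 0 < sep x (aroot k) then (dlen x - 2)%N else (dlen x + 2)%N.
Proof.
have hk := aroot_root k; have hkN := etrans (rootN D _) hk.
pose s := s_aff D k.
pose rest := (\sum_(a <- undup Phi | (a != aroot k) && (a != - aroot k))
  `|sep x a|)%N.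
have split2 := big_root_pm _ hk.
have e1 : dlen x = (`|sep x (aroot k)| + (`|sep x (aroot k)| + rest))%N.
  by rewrite /dlen split2 sepN // abszN.
have e2 : dlen (s * x)%g = (`|sep x (aroot k) - 1| + (`|sep x (aroot k) - 1| + rest))%N.
  rewrite /dlen -(big_root_weyl s.2) split2.
  have eF b : b \in Phi -> sep (s * x)%g (s.2 b) = sep x b - (b == aroot k)%:Z + (b
    == - aroot k)%:Z.
    move=> hb; rewrite sepM ?weyl_root // weylK /s s_aff_lin sep_affE ?refl_root //.
    rewrite !(can2_eq (reflK hk) (reflK hk)) refl_self //.
    have -> : reflV D (aroot k) (- aroot k) = aroot k.
      by rewrite linearN /= refl_self // opprK.
    by ring.
  have N := negPf (rootN_neq hk).
  rewrite !eF // eqxx N (eq_sym (aroot k)) N eqxx sepN //.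
  congr (_ + (_ + _))%N; [lia|lia|].
  rewrite big_seq_cond [RHS]big_seq_cond; apply: eq_bigr => a.
  rewrite mem_undup => /and3P[ha n1 n2]; rewrite eF // (negPf n1) (negPf n2).
  by rewrite subr0 addr0.
by rewrite e1 e2; case: ifP; lia.
Qed.

Lemma dlen_s_ge k x : 0 < sep x (aroot k) -> (2 <= dlen x)%N.
Proof.
move=> h; have hk := aroot_root k; rewrite /dlen.
by rewrite (big_root_pm _ hk) sepN //; lia.
Qed.

(* All affine simple roots take the value 1 / [cox] at the point rho / [cox], where
   [cox] is the Coxeter number; [pt x] is [cox] times the image of this point
   under [x]. *)
Definition cox : R := ht th + 1.
Definition pt x : V := x.2 (rho D : V) + cox *: (x.1 : V).

Lemma ip_pt x a : a \in Phi ->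
  '[a, pt x] = ht ((x.2)^-1%g a) + cox * (pairing a x.1)%:~R.
Proof. by move=> ha; rewrite ipDr ipZr pairingE // -ip_weylV. Qed.

(** The right-hand side is [ht b + cox * m] with [b] a root and [m] an integer. Heights of roots are
    smaller than [cox] in absolute value, so the sign is that of [m], and that of [ht b] when [m] is
    0. *)
Lemma sep_le0 x a : a \in Phi ->
  (sep x a <= 0) = (0 < '[a, pt x] + cox * (eps a)%:~R).
Proof.
move=> ha; rewrite ip_pt // -addrA -mulrDr -rmorphD /= /sep.
move: (weyl_root (x.2)^-1%g ha); set b := (x.2)^-1%g a => hb.
set m := pairing _ _ + _; have -> : (eps b - pairing a x.1 - eps a <= 0) = (eps b
  <= m) by rewrite /m; lia.
have hbN := theta_ht (etrans (rootN D b) hb); rewrite htN in hbN.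
have hbP := theta_ht hb; have tp := theta_pos D.
have tm (z : int) : (1 <= z) -> cox <= cox * z%:~R.
  by move=> hz; rewrite ler_peMr ?ler1z // /cox; move: tp; rewrite /is_pos; lra.
rewrite /eps /pos; case: ifP => pb.
  case: (lerP 0 m) => hm; apply/esym.
    by apply: ltr_wpDr => //; rewrite mulr_ge0 ?ler0z // /cox; move: tp;
      rewrite /is_pos; lra.
  apply/negbTE; rewrite -leNgt; have := tm (- m) ltac:(lia).
  by rewrite rmorphN /= mulrN /cox; lra.
have nb : ht b < 0 by move: (posN hb); rewrite /is_pos pb htN /= oppr_gt0.
case: (lerP 1 m) => hm; apply/esym.
  by have := tm m hm; rewrite {1}/cox; lra.
apply/negbTE; rewrite -leNgt.
suff : 0 <= cox * (- m)%:~R by rewrite rmorphN /= mulrN; lra.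
by rewrite mulr_ge0 ?ler0z; [|rewrite /cox; move: tp; rewrite /is_pos; lra|lia].
Qed.

(** By [sep_le0] the hypothesis puts [pt x] inside the dilated fundamental alcove. Then every
    [sep x a] is at most 0, and the opposite root gives the reverse inequality. *)
Lemma sep_eq0 x : (forall k, sep x (aroot k) <= 0) ->
  forall a, a \in Phi -> sep x a = 0.
Proof.
move=> h.
have hS l : 0 < '[al l, pt x].
  have := h (lift ord0 l); rewrite arootS sep_le0 ?simple_root //.
  by rewrite /eps pos_simple mulr0 addr0.
have h0 : 0 < - '[th, pt x] + cox.
  have := h ord0; rewrite aroot0 sep_le0 ?rootN ?theta_root // ipNl.
  by rewrite epsN ?theta_root // /eps theta_pos subr0 mulr1.
have nn v : nneg_comb (simple D) v -> 0 <= '[v, pt x].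
  case=> c ->; rewrite ip_suml sumr_ge0 // => l _.
  by rewrite ipMnl mulrn_wge0 // ltW.
have le a : a \in Phi -> sep x a <= 0.
  move=> ha; rewrite sep_le0 // /eps; case: ifP => pa.
    rewrite mulr0 addr0; have na := root_nneg ha pa.
    rewrite lt_def nn // andbT; apply: contraTneq pa.
    case: na => c ->; rewrite ip_suml => /eqP.
    rewrite psumr_eq0 => [/allP z|l _]; last by rewrite ipMnl mulrn_wge0 // ltW.
    rewrite big1 ?/is_pos ?/height ?ip0l ?ltxx // => l _.
    have := z l (mem_index_enum l); rewrite /= ipMnl mulrn_eq0.
    by rewrite (gt_eqF (hS l)) orbF => /eqP ->.
  (* For negative [a], [th + a] is still a natural combination of simple roots, so [a] is at least
     minus theta at [pt x], hence above [- cox]. *)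
  rewrite mulr1; have /nn := theta_nneg (etrans (rootN D a) ha).
  by rewrite opprK ipDl; lra.
move=> a ha; apply/eqP; rewrite eq_le le // -oppr_le0 -sepN //.
by rewrite le ?rootN.
Qed.

Lemma dlen_desc x : dlen x != 0%N -> exists k, 0 < sep x (aroot k).
Proof.
move=> h; apply: contrapT => n; move/eqP: h; apply; apply/dlen_eq0.
by apply: sep_eq0 => k; rewrite leNgt; apply/negP => hk; apply: n; exists k.
Qed.

Lemma refl_weyl w a v : a \in Phi -> reflV D (w a) v = w (reflV D a ((w^-1)%g v)).
Proof.
by move=> ha; rewrite !reflE weylB weylZ weylVK !cartE ip_weyl ip_weylV.
Qed.

Lemma ip_inj (v v' : V) : (forall l, '[al l, v] = '[al l, v']) -> v = v'.
Proof.
move=> h; apply/eqP; rewrite -subr_eq0; apply/eqP.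
have : '[v - v', v - v'] = 0.
  rewrite {1}(simple_decomp D (v - v')) ip_suml big1 // => l _.
  by rewrite ipZl ipDr ipNr h subrr mulr0.
by apply: contra_eq => /ip_gt0/lt0r_neq0.
Qed.

(** Once the linear parts agree, [sep] at the simple roots recovers their pairings with the
    translation part. *)
Lemma ext_eq x y : x.2 =1 y.2 -> (forall a, a \in Phi -> sep x a = sep y a) -> x = y.
Proof.
case: x y => i w [i' w'] /= e2 e.
have ew : w = w' by apply/val_inj/lfunP.
rewrite -{w'}ew in e e2 *; congr (_, _); apply/val_inj/ip_inj => l /=.
have hl := simple_root D l; rewrite -!pairingE //; congr _%:~R.
by have := e _ hl; rewrite /sep /=; lia.
Qed.

(** Conjugating by an element that separates nothing merely transports the one wall crossed by the
    reflection. By [dlen_desc] the conjugate crosses the wall of some affine simple root, so the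
    transported wall is that one. *)
Lemma sep0_conj x k : (forall a, a \in Phi -> sep x a = 0) ->
  exists l, (x * s_aff D k * x^-1)%g = s_aff D l.
Proof.
move=> h; set y := (_ * _ * _)%g; have hk := aroot_root k.
have ey a : a \in Phi -> sep y a = sep (s_aff D k) ((x.2)^-1%g a).
  move=> ha; rewrite /y -mulgA sepM // h // add0r sepM ?weyl_root //.
  by rewrite sepV ?weyl_root ?h ?weyl_root // oppr0 addr0.
have [l hl] : exists l, 0 < sep y (aroot l).
  apply: dlen_desc; apply/eqP => /dlen_eq0 /(_ _ (weyl_root x.2 hk)).
  by rewrite ey ?weyl_root // weylK sep_aff_self.
have el : aroot l = x.2 (aroot k).
  move: hl; rewrite ey ?aroot_root // sep_affE ?weyl_root ?aroot_root //.
  by case: eqP => [<- _|_]; [rewrite weylVK | case: eqP].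
exists l; apply: ext_eq => [v|a ha].
  rewrite s_aff_lin el refl_weyl // /y -s_aff_lin /=.
  by rewrite !comp_lfunE.
rewrite ey // !sep_affE ?weyl_root // el -weylN.
by rewrite !(can2_eq (weylVK x.2) (weylK x.2)).
Qed.

Lemma sep0_Omega x : (forall a, a \in Phi -> sep x a = 0) -> Omega x.
Proof.
move=> h; rewrite /Omega /=; apply/seteqP; split=> [_ [_ [k _ <-] <-]|_ [k _ <-]].
  by have [l ->] := sep0_conj k h; exists l.
have hV a : a \in Phi -> sep x^-1%g a = 0.
  by move=> ha; rewrite sepV // h ?oppr0 ?weyl_root.
have [l el] := sep0_conj k hV; exists (s_aff D l); first by exists l.
by rewrite -el invgK !mulgA mulgV mul1g mulgK.
Qed.

(** If [x] permutes the simple reflections, then at the image of the base point under the inverse of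
    [x] every affine simple root takes, up to sign, its original value. A positive combination of
    the affine simple roots is constant, so no sign can change, and the alcove is preserved. *)
Lemma Omega_sep0 x : Omega x -> forall a, a \in Phi -> sep x a = 0.
Proof.
rewrite /Omega /= => hO.
have conj k : exists l, (x * s_aff D k * x^-1)%g = s_aff D l.
  have : range (s_aff D) (x * s_aff D k * x^-1)%g.
    by rewrite -hO; exists (s_aff D k) => //; exists k.
  by case=> l _ <-; exists l.
(* The value of the k-th affine simple root at the moved base point, scaled by [cox]. *)
pose G k := '[aroot k, pt x^-1%g] + cox * (eps (aroot k))%:~R.
have eG k : G k = ht (x.2 (aroot k)) + cox * (sep x (x.2 (aroot k)) + eps (x.2
  (aroot k)))%:~R.
  rewrite /G ip_pt ?aroot_root // invgK -addrA -mulrDr -rmorphD /=.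
  congr (_ + _ * _%:~R); rewrite pairingNr ?aroot_root // pairing_weyl invgK /sep
    weylK; lia.
have one k : ht (aroot k) + cox * (eps (aroot k))%:~R = 1.
  case: (unliftP ord0 k) => [l|] ->.
    by rewrite arootS ht_simple /eps pos_simple mulr0 addr0.
  by rewrite aroot0 htN epsN ?theta_root // /eps theta_pos subr0 /cox; lra.
have dich k : (G k = 1 /\ sep x (x.2 (aroot k)) = 0) \/ G k = -1.
  have hk := aroot_root k; have hb := weyl_root x.2 hk.
  have [l el] := conj k; have hl := aroot_root l.
  (* The cocycle rule along [x * s_k * x^-1] counts [sep x] twice, and the reflection itself once.
     The right-hand side is 1, -1 or 0, and parity rules out 0. *)
  have e : 2 * sep x (x.2 (aroot k)) + 1 = sep (s_aff D l) (x.2 (aroot k)).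
    rewrite -el -mulgA sepM // weylK sepM // sep_aff_self sepV ?weyl_root //.
    rewrite s_aff_linV refl_self // weylN sepN //; lia.
  rewrite eG; move: e hb; set b := x.2 (aroot k); set z := sep x b => e hb.
  have [eb|n1] := eqVneq b (aroot l).
    have z0 : z = 0.
      by move: e; rewrite eb sep_aff_self; clear; lia.
    by left; rewrite z0 add0r eb one.
  have [eb|n2] := eqVneq b (- aroot l).
    have z1 : z = -1.
      by move: e; rewrite eb sepN // sep_aff_self; clear; lia.
    right; rewrite z1 eb epsN // htN addrA addNr sub0r.
    by rewrite rmorphN /= mulrN -opprD one.
  by move: e; rewrite sep_aff_other //; clear; lia.
have [c ec] : nneg_comb (simple D) th := root_nneg (theta_root D) (theta_pos D).
(* Every simple root occurs in theta, because theta minus that root is again a natural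
   combination. *)
have c_gt0 l : (0 < c l)%N.
  have [m] := coord_nneg l (theta_nneg (simple_root D l)).
  rewrite linearB /= coord_simple eqxx ec linear_sum (bigD1 l) //= big1 => [|l' nl].
    rewrite linearMn /= coord_simple eqxx addr0 => /eqP.
    by rewrite subr_eq -natrD eqr_nat => /eqP ->; rewrite addn1.
  by rewrite linearMn /= coord_simple eq_sym (negPf nl) mul0rn.
(* With these weights the linear parts cancel, as theta is the sum of the [c l] times the simple
   roots. *)
have sumG : G ord0 + \sum_l (c l)%:R * G (lift ord0 l) = cox.
  rewrite {1}/G aroot0 epsN ?theta_root // /eps theta_pos subr0 mulr1 ipNl {1}ec
    ip_suml.
  rewrite addrAC [X in _ + X + _](eq_bigr (fun l => '[al l *+ c l, pt x^-1%g])).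
    by rewrite addNr add0r.
  by move=> l _; rewrite /G arootS /eps pos_simple mulr0 addr0 ipMnl mulr_natl.
have sumc : 1 + \sum_l (c l)%:R = cox by rewrite /cox {1}ec ht_sum natr_sum addrC.
have Gle k : 0 <= 1 - G k by case: (dich k) => [[-> _]|->]; lra.
(* A vanishing sum of nonnegative terms with positive weights, so each [G k] is 1. *)
have z : (1 - G ord0) + \sum_l (c l)%:R * (1 - G (lift ord0 l)) = 0.
  under eq_bigr do rewrite mulrBr mulr1.
  rewrite sumrB; move: sumG sumc; lra.
have G_1 k : G k = 1.
  have nn : 0 <= \sum_l (c l)%:R * (1 - G (lift ord0 l)).
    by apply: sumr_ge0 => l _; rewrite mulr_ge0.
  case: (unliftP ord0 k) => [l|] ->; last by move: (Gle ord0) nn z; lra.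
  have : \sum_l (c l)%:R * (1 - G (lift ord0 l)) = 0.
    by move: (Gle ord0) nn z; lra.
  move/eqP; rewrite psumr_eq0 => [/allP /(_ l (mem_index_enum l))|l' _];
    last by rewrite mulr_ge0.
  rewrite /= mulf_eq0 pnatr_eq0 (gtn_eqF (c_gt0 l)) subr_eq0 /=.
  by move/eqP.
have zV : forall a, a \in Phi -> sep x^-1%g a = 0.
  apply: sep_eq0 => k; rewrite sepV ?aroot_root //.
  case: (dich k) => [[_ ->]|]; first by rewrite oppr0.
  by rewrite G_1 => e; exfalso; move: e; lra.
move=> a ha; apply/eqP; rewrite -oppr_eq0.
by rewrite -[a](weylVK x.2) -sepV ?weyl_root // zV ?weyl_root.
Qed.

(** * Comparison of the hyperplane count with the length *)

Lemma dlen_Omega x : Omega x -> dlen x = 0%N.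
Proof. by move=> /Omega_sep0/dlen_eq0. Qed.

Lemma has_expr_dlen x m : has_expr x m -> (dlen x <= m.*2)%N.
Proof.
case=> om [ks [hom ->]]; rewrite (leq_trans (dlenM_le _ _)) //.
rewrite dlen_Omega // add0n; case: ks => ks /= /eqP <- {m}.
elim: ks => [|k ks IH]; first by rewrite big_nil (proj2 (dlen_eq0 _)) // => a _;
  rewrite sep1.
by rewrite big_cons dlen_s; case: ifP => _ /=; lia.
Qed.

(** Simple reflections are removed on the right as long as some simple wall separates the alcove
    from its image under the inverse of [x]; each removal lowers [dlen] by 2, and what remains at 0
    lies in [Omega]. *)
Lemma dlen_has_expr x : exists2 m, dlen x = m.*2 & has_expr x m.
Proof.
have [n] := ubnP (dlen x); elim: n x => // n IH x lt.
have [z|nz] := eqVneq (dlen x) 0%N.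
  exists 0%N; first exact: z.
  exists x, [tuple]; split; first exact/sep0_Omega/dlen_eq0.
  by rewrite big_nil mulg1.
have [k hk] : exists k, 0 < sep x^-1%g (aroot k) by apply: dlen_desc; rewrite dlenV.
pose y := (x * s_aff D k)%g.
have ey : (dlen y + 2 = dlen x)%N.
  have -> : dlen y = dlen (s_aff D k * x^-1)%g by rewrite -dlenV invgM s_affV.
  by rewrite dlen_s hk (subnK (dlen_s_ge hk)) dlenV.
have [|m em [om [ks [hom e]]]] := IH y; first by lia.
exists m.+1; first by rewrite -ey em doubleS addn2.
exists om, [tuple of rcons ks k]; split=> //=.
by rewrite -cats1 big_cat big_seq1 /= mulgA -e -mulgA s_affK mulg1.
Qed.

Lemma len_dlen x : dlen x = (len x).*2.
Proof.
have [m em hm] := dlen_has_expr x.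
(* A minimum exists, so [xget] does not return its default. *)
have mem : [set m | has_expr x m /\ forall m', has_expr x m' -> (m <= m')%N]%classic m.
  by split=> // m' /has_expr_dlen; rewrite em leq_double.
have := @xgetPex _ 0%N _ (ex_intro _ m mem); rewrite -/(len x) => -[h1 h2].
have := has_expr_dlen h1; have := h2 m hm; lia.
Qed.

Lemma len1 : len (1%g : ext_weyl D) = 0%N.
Proof.
have := len_dlen 1%g; rewrite (proj2 (dlen_eq0 _)) => [|a _]; last exact: sep1.
lia.
Qed.

Lemma lenV x : len x^-1%g = len x.
Proof. by have := dlenV x; rewrite !len_dlen; lia. Qed.

Lemma len_eq0 x : len x = 0%N <-> forall a, a \in Phi -> sep x a = 0.
Proof. by rewrite -dlen_eq0 len_dlen; split; lia. Qed.

Lemma lenM x y :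
  (forall a, a \in Phi -> 0 <= sep x a * sep y ((x.2)^-1%g a)) ->
  len (x * y)%g = (len x + len y)%N.
Proof. by move/dlenM; rewrite !len_dlen; lia. Qed.

Lemma len0M x y : len x = 0%N -> len (x * y)%g = len y.
Proof.
move=> h; rewrite lenM ?h // => a ha.
by rewrite (proj1 (len_eq0 x)) ?mul0r.
Qed.

Lemma len_s k x :
  len (s_aff D k * x)%g = (len x).+1 \/ len x = (len (s_aff D k * x)%g).+1.
Proof.
have := dlen_s k x; case: ifP => [/dlen_s_ge|_]; rewrite !len_dlen; lia.
Qed.

Lemma len_desc x : len x != 0%N -> exists k, len x = (len (s_aff D k * x)%g).+1.
Proof.
move=> h; have /dlen_desc[k hk] : dlen x != 0%N by rewrite len_dlen; lia.
exists k; have := dlen_s k x; rewrite hk; have := dlen_s_ge hk.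
by rewrite !len_dlen; lia.
Qed.

Lemma len_aff k : len (s_aff D k) = 1%N.
Proof. by have := len_s k 1%g; rewrite mulg1 len1; lia. Qed.

(** * Finite Weyl group elements and dominant translations *)

Lemma pairing_dominant a i : a \in Phi -> pos a -> dominant i -> 0 <= pairing a i.
Proof.
move=> ha pa di; rewrite -(ler0z R) pairingE //.
have [c ->] := root_nneg ha pa; rewrite ip_suml sumr_ge0 // => l _.
by rewrite ipMnl mulrn_wge0 // natr_ge0.
Qed.

(** Let [b] be the image of [a] under the inverse of [w]. If [b] is positive both cocycle terms are
    at most 0, if it is negative both are at least 0, so [lenM] applies. *)
Lemma len_fin_transl w i : dominant i ->
  len (fin w * transl i)%g = (len (fin w) + len (transl i))%N.
Proof.
move=> di; apply: lenM => a ha; rewrite sep_fin sep_transl /=.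
have hb := weyl_root (w^-1)%g ha; set b := (w^-1)%g a in hb *.
case: (boolP (pos b)) => pb.
  have := pairing_dominant hb pb di; rewrite /eps pb; case: (pos a); nia.
have := pairing_dominant (etrans (rootN D b) hb) (etrans (posN hb) pb) di.
by rewrite pairingNl // /eps (negPf pb); case: (pos a); nia.
Qed.

Lemma len_fin_s w l : pos (w (al l)) ->
  len (fin (w * simple_refl D l)%g) = (len (fin w)).+1.
Proof.
move=> p; have -> : fin (w * simple_refl D l)%g = (fin w * s_aff D (lift ord0 l))%g.
  by rewrite s_affS; congr (_, _); rewrite /= weyl_act0 addr0.
rewrite lenM ?len_aff ?addn1 // => a ha; rewrite sep_affE ?weyl_root // arootS.
have z : sep (fin w) (w (al l)) = 0.
  by rewrite sep_fin weylK /eps p pos_simple.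
case: eqP => [e|_]; first by rewrite -[a](weylVK w) e z mul0r.
case: eqP => [e|_]; last by rewrite mulr0.
by rewrite -[a](weylVK w) e weylN sepN ?weyl_root ?simple_root // z oppr0 mul0r.
Qed.

(** If [w] kept all simple roots positive it would preserve positivity of every root and have length
    0. So it makes some [al l] negative, and cancelling that reflection on the right gives [w']. *)
Lemma fin_desc w : len (fin w) != 0%N ->
  exists w' l, w = (w' * simple_refl D l)%g /\ pos (w' (al l)).
Proof.
move=> nz; have [l hl] : exists l, ~~ pos (w (al l)).
  apply: contrapT => h; move/eqP: nz; apply; apply/len_eq0.
  have h' l : pos (w (al l)) by apply: contraT => hl; case: h; exists l.
  have hp b : b \in Phi -> pos b -> pos (w b).
    move=> hb pb; have [c ec] := root_nneg hb pb.
    have p0 : 0 <= height D (w b).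
      rewrite ec linear_sum /height ip_suml sumr_ge0 // => l _.
      by rewrite linearMn ipMnl mulrn_wge0 //; apply: ltW; apply: h'.
    apply: contraT => nb; have := posN (weyl_root w hb);
      rewrite nb /= /is_pos htN => n0.
    by move: n0 p0; lra.
  move=> a ha; rewrite sep_fin; set b := (w^-1)%g a.
  have hb : b \in Phi by apply: weyl_root.
  have -> : a = w b by rewrite weylVK.
  rewrite /eps; case: (boolP (pos b)) => pb; first by rewrite hp.
  have := hp (- b); rewrite rootN weylN !posN ?weyl_root // => /(_ isT pb).
  by case: (pos _).
exists (w * simple_refl D l)%g, l; split.
  rewrite -mulgA; have -> : (simple_refl D l * simple_refl D l = 1)%g.
    by apply: val_inj; rewrite /= reflVV ?simple_root.
  by rewrite mulg1.
by rewrite weylM /= refl_self ?simple_root // weylN posN ?weyl_root ?simple_root.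
Qed.

End Length.

(** * The Hecke algebra *)

Section Span.
Variables (A : comNzRingType) (K : choiceType) (M : lmodType A).
Implicit Types (F : K -> M) (c : {malg A[K]}) (P : K -> Prop).

Definition mlin F c : M := \sum_(k <- msupp c) c@_k *: F k.

Lemma mlinEw F c (X : {fset K}) : (msupp c `<=` X)%fset ->
  mlin F c = \sum_(k <- X) c@_k *: F k.
Proof.
move=> le; rewrite /mlin; apply: big_fset_incl => // k _.
by move/mcoeff_outdom ->; rewrite scale0r.
Qed.

Fact mlin_is_linear F : linear (mlin F).
Proof.
move=> a c1 c2; pose X := (msupp c1 `|` msupp c2)%fset.
have le1 : (msupp c1 `<=` X)%fset by rewrite fsubsetUl.
have le2 : (msupp c2 `<=` X)%fset by rewrite fsubsetUr.
have le : (msupp (a *: c1 + c2) `<=` X)%fset.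
  apply: fsubset_trans (msuppD_le _ _) _; rewrite fsubUset le2 andbT.
  exact: fsubset_trans (msuppZ_le _ _) le1.
rewrite !(mlinEw F (X := X)) // scaler_sumr -big_split /=.
by apply: eq_bigr => k _; rewrite mcoeffD mcoeffZ scalerDl scalerA.
Qed.
HB.instance Definition _ F :=
  GRing.isLinear.Build A {malg A[K]} M *:%R (mlin F) (mlin_is_linear F).

Lemma mlinU F k : mlin F (mkmalgU k 1) = F k.
Proof.
by rewrite (mlinEw _ msuppU_le) big_seq_fset1 mcoeffUU scale1r.
Qed.

Lemma eq_mlin F F' c : (forall k, c@_k != 0 -> F k = F' k) -> mlin F c = mlin F' c.
Proof.
move=> h; rewrite /mlin; apply: eq_big_seq => k; rewrite -mcoeff_neq0.
by move/h ->.
Qed.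

Definition spanned P F (y : M) : Prop :=
  exists2 c, y = mlin F c & forall k, c@_k != 0 -> P k.

Lemma spanned_gen P F k : P k -> spanned P F (F k).
Proof.
move=> pk; exists (mkmalgU k 1); first by rewrite mlinU.
by move=> k'; rewrite mcoeffU; have [<- //|_] := eqVneq k k'; rewrite mulr0n eqxx.
Qed.

Lemma spanned_lin P F a y y' : spanned P F y -> spanned P F y' ->
  spanned P F (a *: y + y').
Proof.
case=> c -> hc [c' -> hc']; exists (a *: c + c'); first by rewrite linearP.
move=> k; rewrite mcoeffD mcoeffZ; have [->|/hc //] := eqVneq c@_k 0.
by rewrite mulr0 add0r => /hc'.
Qed.

Lemma spanned0 P F : spanned P F 0.
Proof. by exists 0; [rewrite linear0 | move=> k; rewrite mcoeff0 eqxx]. Qed.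

Lemma spanned_sub P P' F y : (forall k, P k -> P' k) ->
  spanned P F y -> spanned P' F y.
Proof. by move=> h [c -> hc]; exists c => // k /hc/h. Qed.

End Span.

Lemma mcoeff_mlin_inj (A : comNzRingType) (K L : choiceType) (f : K -> L)
    (c : {malg A[K]}) k : injective f ->
  mcoeff (f k) (mlin (fun k => mkmalgU (f k) 1 : {malg A[L]}) c) = c@_k.
Proof.
move=> f_inj; rewrite [in RHS](monalgE c) /mlin !raddf_sum /=.
by apply: eq_bigr => k' _; rewrite mcoeffZ !mcoeffU inj_eq // mulr_natr.
Qed.

Lemma linear_mlin (A : comNzRingType) (K : choiceType) (M N : lmodType A)
  (g : {linear M -> N}) (F : K -> M) (c : {malg A[K]}) :
  g (mlin F c) = mlin (g \o F) c.
Proof. by rewrite /mlin linear_sum; apply: eq_bigr => k _; rewrite linearZ. Qed.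

Lemma spanned_map (A : comNzRingType) (K L : choiceType) (M N : lmodType A)
    (g : M -> N) (P : K -> Prop) (Q : L -> Prop) F G y : linear g ->
  (forall k, P k -> spanned Q G (g (F k))) ->
  spanned P F y -> spanned Q G (g y).
Proof.
move=> g_lin h [c -> hc].
pose gL : {linear M -> N} := HB.pack g (GRing.isLinear.Build _ _ _ _ g g_lin).
rewrite -[g]/(gL : M -> N) linear_mlin /mlin big_seq.
elim/big_rec: _ => [|k z]; first exact: spanned0.
by rewrite -mcoeff_neq0 => /hc/h; apply: spanned_lin.
Qed.

Section Hecke.
Variables (R : realType) (V : vectType R) (d : nat) (D : root_datum V d).
Variables (H : unitAlgType laurent) (h_ : ext_weyl D -> H).
Hypothesis hecke_H : is_affine_hecke h_.
Local Notation "'[ x , y ]" := (ip D x y).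
Local Notation Phi := (roots D).
Local Notation al := (tnth (simple D)).
Implicit Types (x y : ext_weyl D) (i j : coweight D) (w : weyl D) (m : nat).

Lemma hecke_span (h : H) : exists c, h = mlin h_ c.
Proof. by have [hb _ _] := hecke_H; have [c [-> _]] := hb h; exists c. Qed.

Lemma heckeM x y : len (x * y)%g = (len x + len y)%N -> h_ x * h_ y = h_ (x * y)%g.
Proof. by have [_ h _] := hecke_H; apply: h. Qed.

(** By additivity of lengths [h_ 1%g] is a left unit on the basis, hence on the expansion of 1. *)
Lemma hecke1 : h_ 1%g = 1.
Proof.
have [c e] := hecke_span 1; rewrite -[LHS]mulr1 e mulr_sumr.
apply: eq_bigr => x _; rewrite -scalerAr heckeM ?mul1g ?len1 //.
Qed.

Lemma hecke_quad k :
  h_ (s_aff D k) * h_ (s_aff D k) = 1 + (lvV - lv) *: h_ (s_aff D k).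
Proof.
have [_ _ /(_ k)] := hecke_H; set h := h_ _ => /eqP.
rewrite mulrBl !mulrDr mulr_algr !mulr_algl scalerA lvVK scale1r subr_eq0.
by move/eqP=> e; rewrite scalerBl addrA (addrC 1) -e addrK.
Qed.

Lemma hecke_s k y : exists c : laurent,
  h_ (s_aff D k) * h_ y = h_ (s_aff D k * y)%g + c *: h_ y.
Proof.
have [e|e] := len_s k y.
  by exists 0; rewrite scale0r addr0 heckeM // e len_aff.
have ey : h_ (s_aff D k) * h_ (s_aff D k * y)%g = h_ y.
  by rewrite heckeM mulgA s_affK mul1g // e len_aff.
exists (lvV - lv); rewrite -{1}ey mulrA hecke_quad mulrDl mul1r -scalerAl.
by rewrite ey.
Qed.

Lemma hecke_desc x : len x != 0%N -> exists k y,
  [/\ (len y < len x)%N, x = (s_aff D k * y)%g & h_ x = h_ (s_aff D k) * h_ y].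
Proof.
move=> /len_desc[k e]; exists k, (s_aff D k * x)%g.
have ex : x = (s_aff D k * (s_aff D k * x))%g by rewrite mulgA s_affK mul1g.
by split; rewrite ?e // heckeM -ex // e len_aff.
Qed.

Lemma hecke_unit x : h_ x \is a GRing.unit.
Proof.
have [m] := ubnP (len x); elim: m x => // m IH x lt.
have [z|] := eqVneq (len x) 0%N; last first.
  case/hecke_desc=> k [y [ly _ ->]].
  have uy : h_ y \is a GRing.unit by apply: IH; apply: leq_trans ly _.
  rewrite unitrMl //.
  (* The inverse of a generator, read off the quadratic relation. *)
  apply/unitrP; exists (h_ (s_aff D k) - (lvV - lv)%:A).
  by rewrite mulrBl mulrBr mulr_algl mulr_algr hecke_quad addrK.
apply/unitrP; exists (h_ x^-1%g).
by rewrite !heckeM ?mulVg ?mulgV ?hecke1 // len1 lenV z.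
Qed.

Definition deep m i := forall k, m%:R <= '[al k, i].

(** Written with the finite part on the left, [x] is w t_j with j the coweight tested here; see
    [ext_decomp]. *)
Definition deepx m x := deep m (weyl_act (x.2)^-1%g x.1).

Lemma deep_dominant m i : deep m i -> dominant i.
Proof.
move=> h k; rewrite natrEint root_int ?simple_root //=.
by apply: le_trans (h k); rewrite ler0n.
Qed.

Lemma root_bounded i : exists C : nat, forall a, a \in Phi -> - C%:R <= '[a, i].
Proof.
exists (\sum_(a <- undup Phi) `|pairing a i|)%N => a ha.
rewrite -pairingE // pmulrn -mulrNz ler_int.
by rewrite (bigD1_seq a) ?mem_undup ?undup_uniq //=; lia.
Qed.

Lemma deep_rho m : deep m (rho D *+ m).
Proof.
move=> k; have -> : (rho D *+ m : coweight D) = (rho D : V) *+ m :> V.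
  by elim: m => // m; rewrite !mulrS /= => ->.
by rewrite ipMnr rhoE.
Qed.

Lemma deep_add m C i j : (forall k, - C%:R <= '[al k, i]) -> deep (m + C) j ->
  deep m (i + j).
Proof.
move=> hi hj k; rewrite /= ipDr; have := hi k; have := hj k.
by rewrite natrD; lra.
Qed.

Lemma dominant_decomp i : exists j1 j2, [/\ dominant j1, dominant j2 & i = j1 - j2].
Proof.
have [C hC] := root_bounded i; exists (i + rho D *+ C), (rho D *+ C); split.
- apply: (@deep_dominant 0); apply: (@deep_add _ C) (deep_rho _) => k.
  by apply: hC; rewrite simple_root.
- exact: deep_dominant (deep_rho _).
- by rewrite addrK.
Qed.

(** Left multiplication by [x] changes the right-hand translation part of [y] by a Weyl conjugate of
    [x.1], whose pairings with the roots are bounded independently of [y]. *)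
Lemma deepx_mul x : exists C, forall m y, deepx (m + C) y -> deepx m (x * y)%g.
Proof.
have [C hC] := root_bounded x.1; exists C => m y hy; rewrite /deepx.
rewrite -[(x * y)%g.1]/(x.1 + weyl_act x.2 y.1) -[(x * y)%g.2]/(x.2 * y.2)%g.
have -> : weyl_act (x.2 * y.2)^-1%g (x.1 + weyl_act x.2 y.1) =
    weyl_act (x.2 * y.2)^-1%g x.1 + weyl_act (y.2)^-1%g y.1.
  by rewrite weyl_actD -weyl_actM invgM -mulgA mulVg mulg1.
apply: deep_add hy => k.
rewrite -[X in '[_, X]]/((x.2 * y.2)^-1%g (x.1 : V)) dotp_sym ip_weylV dotp_sym.
by apply: hC; rewrite weyl_root ?simple_root.
Qed.

Lemma deepx_le m m' x : (m <= m')%N -> deepx m' x -> deepx m x.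
Proof. by move=> le h k; apply: le_trans (h k); rewrite ler_nat. Qed.

Definition hdeep m := spanned (deepx m) h_.

Lemma hdeep_le m m' (h : H) : (m <= m')%N -> hdeep m' h -> hdeep m h.
Proof. by move=> le; apply: spanned_sub => x; apply: deepx_le. Qed.

(* Hence [h] times a deep translation is a combination of products H_w theta_j with
   j dominant; this replaces the Bernstein relation. *)
Lemma hdeep_mul (h : H) : exists C, forall m (u : H),
  hdeep (m + C) u -> hdeep m (h * u).
Proof.
have mulL (a : H) : linear ( *%R a) by move=> c u v; rewrite mulrDr scalerAr.
have [c ->] := hecke_span h; rewrite /mlin.
elim/big_rec: _ => [|x u _ [C hC]].
  by exists 0%N => m y _; rewrite mul0r; apply: spanned0.
suff [C' hC'] : exists C, forall m (y : H),
    hdeep (m + C) y -> hdeep m (h_ x * y).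
  exists (C + C')%N => m y hy; rewrite mulrDl -scalerAl; apply: spanned_lin.
    by apply: hC'; apply: hdeep_le hy; rewrite leq_add2l leq_addl.
  by apply: hC; apply: hdeep_le hy; rewrite leq_add2l leq_addr.
have [l] := ubnP (len x); elim: l x {u C hC} => // l IH x lt.
have [z|/hecke_desc[k [x' [lx _ ->]]]] := eqVneq (len x) 0%N.
  have [C hC] := deepx_mul x; exists C => m u;
    apply: (spanned_map (mulL (h_ x))) => y hy.
  by rewrite heckeM ?len0M ?z //; apply/spanned_gen/hC.
have [C hC] := IH x' (leq_trans lx lt).
have [C' hC'] := deepx_mul (s_aff D k).
(* The factor [x'] costs depth [C]. The reflection then yields two terms: the product, which costs
   [C'], and the unchanged element, which costs nothing. *)
exists (C' + C)%N => m y; rewrite -mulrA addnA => /hC.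
apply: (spanned_map (mulL (h_ (s_aff D k)))) => z hz; have [c' ->] := hecke_s k z.
rewrite addrC; apply: spanned_lin; apply: spanned_gen; last exact: hC'.
by apply: deepx_le hz; rewrite leq_addr.
Qed.

Lemma hecke_dominant (h : H) :
  exists2 k, dominant k & hdeep 0 (h * h_ (transl k)).
Proof.
have [C hC] := hdeep_mul h; exists (rho D *+ C);
  first exact: deep_dominant (deep_rho _).
apply: hC; apply: spanned_gen; rewrite /deepx /= invg1 weyl_act1; exact: deep_rho.
Qed.

End Hecke.

(** * The module *)

Section Module.
Variables (R : realType) (V : vectType R) (d : nat) (D : root_datum V d).
Variables (n : nat) (Xf : invariant_set D n).
Variables (H : unitAlgType laurent) (h_ : ext_weyl D -> H).
Variable Ups : H -> {linear Tf Xf -> Tf Xf}.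
Hypotheses (Xf_dom : is_fundamental_domain Xf) (hecke_H : is_affine_hecke h_).
Hypotheses (Ups_action : is_right_action Ups) (Ups_spec : Tf_action_spec h_ Ups).
Local Notation "'[ x , y ]" := (ip D x y).
Local Notation al := (tnth (simple D)).
Local Notation U := (@u_ _ _ _ _ _ Xf).
Implicit Types (x y : ext_weyl D) (i j : Xf_elt Xf) (t : coweight D) (w : weyl D).
Implicit Types (h g : H) (l : 'I_d).

Lemma Ups1 m : Ups 1 m = m. Proof. by have [] := Ups_action. Qed.
Lemma UpsM h g m : Ups (h * g) m = Ups g (Ups h m).
Proof. by have [_ e _] := Ups_action. Qed.
Lemma Ups_linear m : linear (fun h => Ups h m).
Proof. by have [_ _ e] := Ups_action => c h g; apply: e. Qed.

Lemma Ups0 m : Ups 0 m = 0.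
Proof.
have := Ups_linear m (-1) 0 0.
by rewrite scaler0 addr0 scaleN1r addNr.
Qed.

Lemma xact1 i : xact i 1%g = i.
Proof. by apply: val_inj; rewrite /= cw_act1. Qed.
Lemma xactM i x y : xact i (x * y)%g = xact (xact i x) y.
Proof. by apply: val_inj; rewrite /= cw_actM. Qed.

Lemma orbit_refl i : orbit i i.
Proof. by exists 1%g; rewrite ?xact1. Qed.
Lemma orbit_act i j x : orbit i j -> orbit i (xact j x).
Proof. by case=> y _ <-; exists (y * x)%g; rewrite ?xactM. Qed.
Lemma orbit_trans i j k : orbit i j -> orbit j k -> orbit i k.
Proof. by move=> h [x _ <-]; apply: orbit_act. Qed.
Lemma orbit_sym i j : orbit i j -> orbit j i.
Proof. by case=> x _ <-; exists x^-1%g; rewrite // -xactM mulgV xact1. Qed.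

Lemma ext_decomp x : x = (fin x.2 * transl (weyl_act (x.2)^-1%g x.1))%g.
Proof.
case: x => t w; congr (_, _) => /=; last by rewrite mulg1.
by rewrite add0r -weyl_actM mulgV weyl_act1.
Qed.

Lemma Ups_transl i t : dominant t ->
  Ups (h_ (transl t)) (U i) = U (xact i (transl t)).
Proof.
move=> dt; have [_] := Ups_spec; apply; exists t, 0; split=> //.
- by move=> k; rewrite /ip linear0r rpred0.
- by rewrite subr0.
- by rewrite (hecke1 hecke_H : h_ (transl 0) = 1) divr1.
Qed.

Lemma Ups_translV i t : dominant t ->
  Ups (h_ (transl t))^-1 (U i) = U (xact i (transl (- t))).
Proof.
move=> dt; have [_] := Ups_spec; apply; exists 0, t; split=> //.
- by move=> k; rewrite /ip linear0r rpred0.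
- by rewrite sub0r.
- by rewrite (hecke1 hecke_H : h_ (transl 0) = 1) mul1r.
Qed.

Lemma Ups_theta i t : exists h, Ups h (U i) = U (xact i (transl t)).
Proof.
have [t1 [t2 [d1 d2 ->]]] := dominant_decomp t.
exists (h_ (transl t1) / h_ (transl t2)).
rewrite UpsM.
rewrite (Ups_transl _ d1).
rewrite (Ups_translV _ d2).
rewrite -xactM.
have <- : (transl t1 * transl (- t2))%g = transl (t1 - t2).
  congr (_, _); last exact: mulg1.
  by rewrite [weyl_act _ _]weyl_act1.
by [].
Qed.

Lemma mcoeff_u i j : (U i)@_j = (i == j)%:R.
Proof. exact: mcoeffU. Qed.

Lemma mcoeff_scale (c : laurent) (m : Tf Xf) j : (c *: m)@_j = c * m@_j.
Proof. exact: mcoeffZ. Qed.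

Lemma mlin_u (m : Tf Xf) : m = mlin U m.
Proof.
rewrite {1}(monalgE m) /mlin; apply: eq_bigr => k _; apply/malgP => j.
by rewrite mcoeff_scale [X in _ = _ * X]mcoeff_u [LHS]mcoeffU mulr_natr.
Qed.

Lemma Tf_comp_ext (f1 f2 g1 g2 : {linear Tf Xf -> Tf Xf}) :
  (forall i, f1 (f2 (U i)) = g1 (g2 (U i))) -> forall m, f1 (f2 m) = g1 (g2 m).
Proof.
move=> e m; rewrite (mlin_u m) (linear_mlin f2) (linear_mlin f1).
rewrite (linear_mlin g2) (linear_mlin g1).
by apply: eq_mlin => i _; apply: e.
Qed.

Lemma Ff_fin i w : Fbox n (val i) -> Ff (xact i (fin w)).
Proof. by move=> hi; exists (w^-1)%g, i; rewrite /= cw_act_fin. Qed.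

Lemma fin_mul_s w l : fin (w * simple_refl D l)%g = (fin w * fin (simple_refl D l))%g.
Proof. by congr (_, _); rewrite /= weyl_act0 addr0. Qed.

Lemma len_fin_simple l : len (fin (simple_refl D l)) = 1%N.
Proof. by rewrite -s_affS len_aff. Qed.

Lemma hecke_fin_s w l : is_pos D (w (al l)) ->
  h_ (fin (w * simple_refl D l)%g) = h_ (fin w) * h_ (fin (simple_refl D l)).
Proof.
move=> p; rewrite (heckeM hecke_H) -fin_mul_s // len_fin_s //.
by rewrite len_fin_simple addn1.
Qed.

Lemma orbit_box i : exists2 i1, orbit i i1 & Fbox n (val i1).
Proof.
have [|i1 [[o b] _]] := Xf_dom (O := orbit i); first by exists i.
by exists i1.
Qed.

(** * Action on the regular orbit *)

Section Regular.
Variable i0 : Xf_elt Xf.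
Hypotheses (i0_box : Fbox n (val i0)) (i0_regular : regular_orbit (orbit i0)).

Lemma xact_inj x y : xact i0 x = xact i0 y -> x = y.
Proof.
move=> e; have [z [_ uz]] := i0_regular (orbit_refl i0) (orbit_act x (orbit_refl i0)).
by rewrite -(uz x) // -(uz y).
Qed.

(* The fundamental domain and the regular orbit replace the theorem that a Weyl
   group element of length zero is trivial. *)
Lemma len_fin_eq0 w : len (fin w) = 0%N -> w = 1%g.
Proof.
move=> /len_eq0 z.
have wpos a : pos_root D a -> pos_root D (w a).
  case/pos_rootE=> ha pa; apply/pos_rootE; split; first exact: weyl_root.
  have := z _ (weyl_root w ha); rewrite sep_fin weylK /eps pa.
  by case: ifP.
have box : Fbox n (val (xact i0 (fin w))).
  move=> a /wpos /i0_box; rewrite ip_weyl.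
  suff -> : '[val (xact i0 (fin w)) : V, a] = '[val i0 : V, w a] by [].
  by rewrite [val (xact _ _)]cw_act_fin; apply: ip_weylV.
have [k [_ uk]] := Xf_dom (ex_intro2 _ _ i0 I erefl : Lambda Xf (orbit i0)).
have e : xact i0 (fin w) = xact i0 1%g.
  rewrite -(uk (xact i0 (fin w))) ?xact1; last by split=> //;
    apply: orbit_act (orbit_refl _).
  by apply: uk; split=> //; apply: orbit_refl.
by have [] := xact_inj e.
Qed.

(** The finite Weyl orbit of a box point lies in [Ff], and each case of the formula for a generator
    stays in its span. This weaker form of [Ups_fin] serves all orbits, regular or not. *)
Lemma Ups_fin_orbit i1 w : Fbox n (val i1) ->
  forall j, (exists w', j = xact i1 (fin w')) ->
  spanned (fun j => exists w', j = xact i1 (fin w')) U (Ups (h_ (fin w)) (U j)).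
Proof.
move=> b1; have [m] := ubnP (len (fin w)); elim: m w => // m IH w lt j hj.
have [/len_fin_eq0->|/fin_desc[w' [l [e p]]]] := eqVneq (len (fin w)) 0%N.
  by rewrite (hecke1 hecke_H : h_ (fin 1%g) = 1) Ups1; apply: spanned_gen.
rewrite e hecke_fin_s // UpsM.
apply: (spanned_map _ _ (IH w' _ j hj)) => [|k [w'' ->]|]; first exact: linearP.
  have [/(_ _ l (Ff_fin w'' b1)) /= -> _] := Ups_spec.
  set s := fin (simple_refl D l).
  have gs : exists w', xact (xact i1 (fin w'')) s = xact i1 (fin w').
    by exists (w'' * simple_refl D l)%g; rewrite fin_mul_s xactM.
  have g1 : exists w', xact i1 (fin w'') = xact i1 (fin w') by exists w''.
  case: ifP => _; first by rewrite -[_ *: _]addr0;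
    apply: spanned_lin (spanned0 _ _); apply: spanned_gen.
  case: ifP => _; first exact: spanned_gen.
  by rewrite addrC; apply: spanned_lin; apply: spanned_gen.
by move: lt; rewrite e len_fin_s.
Qed.

(** Along a reduced word every step goes up in the dominance order: box points pair nonpositively
    with positive roots, and regularity excludes a zero pairing. So only the case without correction
    term of the formula occurs. *)
Lemma Ups_fin w : Ups (h_ (fin w)) (U i0) = U (xact i0 (fin w)).
Proof.
have [m] := ubnP (len (fin w)); elim: m w => // m IH w lt.
have [/len_fin_eq0->|/fin_desc[w' [l [e p]]]] := eqVneq (len (fin w)) 0%N.
  by rewrite (hecke1 hecke_H : h_ (fin 1%g) = 1) Ups1 -[fin 1%g]/(1%g : ext_weyl D)
    xact1.
have lw : len (fin w) = (len (fin w')).+1 by rewrite e len_fin_s.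
rewrite e hecke_fin_s // UpsM IH ?fin_mul_s ?xactM; last by move: lt; rewrite lw.
have [/(_ _ l (Ff_fin w' i0_box)) /= -> _] := Ups_spec.
set s := fin (simple_refl D l).
have ns : xact (xact i0 (fin w')) s != xact i0 (fin w').
  apply/eqP; rewrite -xactM -[RHS](congr1 (xact i0) (mulg1 _)) => /xact_inj/mulgI es.
  by have := len_fin_simple l; rewrite -/s es len1.
rewrite (negPf ns); case: ifP => // /negbT; rewrite -leNgt => ge0; exfalso.
move/eqP: ns; apply; apply: val_inj; rewrite /= !cw_act_fin.
set v := val i0; have e1 : '[al l, weyl_act (w'^-1)%g v] = '[w' (al l), v].
  by rewrite dotp_sym ip_weylV dotp_sym.
have : pos_root D (w' (al l)) by apply/pos_rootE; rewrite weyl_root ?simple_root.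
have gt := root_gt0 (weyl_root w' (simple_root D l)).
move/i0_box => /andP[_]; rewrite pmulr_lle0 ?invr_gt0 // pmulr_rle0 // dotp_sym => le0.
(* A zero pairing means that the reflection fixes the point, against [ns]. *)
have z : '[al l, weyl_act (w'^-1)%g v] = 0.
  apply/eqP; rewrite eq_le {1}e1 le0 andTb.
  by rewrite -(cw_act_fin n v w'); exact: ge0.
apply: val_inj; rewrite -weyl_actM.
have -> : ((simple_refl D l)^-1 = simple_refl D l)%g.
  apply: (mulgI (simple_refl D l)); rewrite mulgV.
  by apply: val_inj; rewrite /= reflVV ?simple_root.
rewrite weyl_actM; set v' := weyl_act (w'^-1)%g v in z *.
by rewrite /= reflE cartE dotp_sym z mulr0 mul0r scale0r subr0.
Qed.

Lemma Ups_dominant x : deepx 0 x -> Ups (h_ x) (U i0) = U (xact i0 x).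
Proof.
move=> /deep_dominant dt; rewrite [in LHS](ext_decomp x).
rewrite -(heckeM hecke_H) ?len_fin_transl //.
rewrite UpsM.
rewrite Ups_fin.
rewrite (Ups_transl _ dt) -xactM -ext_decomp.
by [].
Qed.

Lemma Ups_onto j : orbit i0 j -> exists g, Ups g (U i0) = U j.
Proof.
case=> x _ <-; rewrite (ext_decomp x) xactM.
have [g eg] := Ups_theta (xact i0 (fin x.2)) (weyl_act (x.2)^-1%g x.1).
by exists (h_ (fin x.2) * g); rewrite UpsM Ups_fin.
Qed.

Lemma Ups_free h : Ups h (U i0) = 0 -> h = 0.
Proof.
move=> e; have [t dt [c ec hc]] := hecke_dominant hecke_H h.
have uk := hecke_unit hecke_H (transl t).
(* The translation acts invertibly, so it is enough to treat the dominant combination. *)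
suff c0 : c = 0 by apply: (mulIr uk); rewrite ec c0 linear0 mul0r.
pose f h := Ups h (U i0).
pose fL : {linear H -> Tf Xf} := HB.pack f (GRing.isLinear.Build _ _ _ _ f
  (Ups_linear (U i0))).
have : mlin (fun x => U (xact i0 x)) c = 0.
  rewrite -(@eq_mlin _ _ _ (fL \o h_)) -?linear_mlin -?ec /= /f ?UpsM ?e ?linear0 //.
  by move=> x /hc/Ups_dominant.
move=> e0; apply/malgP => x.
have := mcoeff_mlin_inj c x xact_inj.
rewrite [X in mcoeff _ X]e0 => <-; rewrite [RHS]mcoeff0; exact: mcoeff0.
Qed.

(** Modulo an invertible translation the algebra element is a combination of products H_w theta_j
    with j dominant. Started from a finite conjugate of a box point, such a product stays in the
    orbit by [Ups_fin_orbit]. *)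
Lemma Ups_orbit i h : spanned (orbit i) U (Ups h (U i)).
Proof.
have [i1 o1 b1] := orbit_box i.
have [x _ ex] := orbit_sym o1.
set Q := fun j => exists w', j = xact i1 (fin w').
(* The translation leading from that conjugate to [i] is absorbed into [h]. *)
have [g eg] := Ups_theta (xact i1 (fin x.2)) (weyl_act (x.2)^-1%g x.1).
have -> : U i = Ups g (U (xact i1 (fin x.2))).
  rewrite [RHS]eg -xactM -ext_decomp.
  exact: (f_equal U (esym ex)).
rewrite -UpsM; set h' := g * h; have [t dt [c ec hc]] := hecke_dominant hecke_H h'.
have uk := hecke_unit hecke_H (transl t).
have -> : h' = (mlin h_ c) / h_ (transl t) by rewrite -ec mulrK.
rewrite UpsM.
apply: (@spanned_map _ _ _ _ _ _ (orbit i) _ U) => [|j oj|].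
- exact: linearP.
- by rewrite Ups_translV //; apply/spanned_gen/orbit_act.
pose f h := Ups h (U (xact i1 (fin x.2))).
have fl : linear f by apply: Ups_linear.
apply: (@spanned_map _ _ _ _ _ f (deepx 0) _ h_) => //; last by exists c.
rewrite /f => y /deep_dominant dy; rewrite (ext_decomp y).
rewrite -(heckeM hecke_H) ?len_fin_transl // UpsM.
apply: (@spanned_map _ _ _ _ _ _ Q _ U) => [|j [w' ->]|].
- exact: linearP.
- by rewrite Ups_transl //; apply/spanned_gen/orbit_act/orbit_act.
- by apply: Ups_fin_orbit => //; exists x.2.
Qed.

(** The value at [U j] of the endomorphism sending [U i0] to [m]: a chosen algebra element taking
    [U i0] to [U j] is applied to [m]. It is zero off the regular orbit. *)
Definition lift_fun (m : Tf Xf) j : Tf Xf :=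
  if pselect (orbit i0 j) is left o then Ups (projT1 (cid (Ups_onto o))) m else 0.

Lemma lift_funN m j : ~ orbit i0 j -> lift_fun m j = 0.
Proof. by move=> h; rewrite /lift_fun; case: pselect. Qed.

Lemma lift_funP j : orbit i0 j -> exists2 g, Ups g (U i0) = U j &
  forall m, lift_fun m j = Ups g m.
Proof.
move=> o; exists (projT1 (cid (Ups_onto o))); first exact: (projT2 (cid (Ups_onto o))).
move=> m; rewrite /lift_fun; case: pselect => // o'.
by rewrite (Prop_irrelevance o' o).
Qed.

Definition lift_map (m : Tf Xf) : {linear Tf Xf -> Tf Xf} := mlin (lift_fun m).

Lemma lift_map_U m j : lift_map m (U j) = lift_fun m j.
Proof. exact: mlinU. Qed.

(** The element [g] depends on [t] only. This uniformity in [m] lets [g] be identified by testing at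
    [U i0]. *)
Lemma lift_map_act (t : Tf Xf) : exists g, forall m, lift_map m t = Ups g m.
Proof.
suff [g eg] : exists g, forall m,
    \sum_(j <- msupp t) t@_j *: lift_fun m j = Ups g m by exists g.
elim: (enum_fset (msupp t)) => [|j s [g eg]].
  by exists 0 => m; rewrite big_nil Ups0.
have [g' eg'] : exists g', forall m, lift_fun m j = Ups g' m.
  have [/lift_funP[g' _ e]|no] := pselect (orbit i0 j); first by exists g'.
  by exists 0 => m; rewrite lift_funN // Ups0.
exists (t@_j *: g' + g) => m.
by rewrite big_cons eg eg' Ups_linear.
Qed.

Lemma lift_map_Ups m h : lift_map m (Ups h (U i0)) = Ups h m.
Proof.
have [g eg] := lift_map_act (Ups h (U i0)); rewrite eg.
suff -> : h = g by [].
apply/eqP; rewrite -subr_eq0; apply/eqP/Ups_free.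
rewrite addrC -scaleN1r Ups_linear -eg scaleN1r addrC.
apply/eqP; rewrite subr_eq0; apply/eqP.
(* [lift_map (U i0)] is the identity on the span of the regular orbit, which contains
   [Ups h (U i0)]. *)
have [c -> hc] := Ups_orbit i0 h; rewrite linear_mlin;
  apply: eq_mlin => j /hc/lift_funP[g' e e'].
by rewrite [RHS]lift_map_U e' e.
Qed.

(** On the regular orbit [lift_map_Ups] reduces commutation to associativity of the action; on any
    other orbit both sides vanish, since the action preserves orbits. *)
Lemma lift_map_schur m : schur_algebra Ups (lift_map m).
Proof.
move=> f [h ef] t; rewrite !ef; move: t; apply: Tf_comp_ext => j.
have [o|no] := pselect (orbit i0 j).
  have [g <- _] := lift_funP o.
  by rewrite -UpsM !lift_map_Ups UpsM.
rewrite [in RHS]lift_map_U lift_funN // linear0.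
have [c -> hc] := Ups_orbit j h; rewrite linear_mlin /mlin big_seq big1 // => k.
rewrite -mcoeff_neq0 => /hc ojk;
  rewrite [(_ \o _) k]lift_map_U lift_funN ?scaler0 // => o.
by apply: no; apply: orbit_trans o (orbit_sym ojk).
Qed.

Lemma double_centralizer : End_over (schur_algebra Ups) = op_image Ups.
Proof.
apply/seteqP; split=> f; last first.
  case=> h ef g Sg m; rewrite !ef; symmetry; apply: Sg; by exists h.
move=> Sf; have comm m (u : Tf Xf) := Sf _ (lift_map_schur m) u.
have id m : lift_map m (U i0) = m by rewrite -[X in lift_map _ X]Ups1 lift_map_Ups Ups1.
(* One [h], found from the image of [U i0], serves for all [m], because [m] is [lift_map m (U i0)]
   and [f] commutes with [lift_map m]. *)
have [h eh] := lift_map_act (f (U i0)).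
exists h => m; rewrite -[in LHS](id m) comm.
by rewrite eh.
Qed.

Lemma Ups_faithful h g : Ups h =1 Ups g -> h = g.
Proof.
move=> e; apply/eqP; rewrite -subr_eq0; apply/eqP/Ups_free.
by rewrite addrC -scaleN1r Ups_linear e scaleN1r addNr.
Qed.

End Regular.
End Module.

Theorem proposition2p4 (R : realType) (V : vectType R) (d : nat)
    (D : root_datum V d) (n : nat) (n_ge2 : (2 <= n)%N)
    (Xf : invariant_set D n) (Xf_dom : is_fundamental_domain Xf)
    (H : unitAlgType laurent) (h_ : ext_weyl D -> H)
    (hecke_H : is_affine_hecke h_)
    (Ups : H -> {linear Tf Xf -> Tf Xf})
    (Ups_action : is_right_action Ups) (Ups_spec : Tf_action_spec h_ Ups)
    (Xf_regular : exists O, Lambda Xf O /\ regular_orbit O) :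
  [/\ schur_algebra Ups = End_over (op_image Ups),
      End_over (schur_algebra Ups) = op_image Ups &
      is_right_alg_iso Ups (op_image Ups)].
Proof.
have [_ [[i _ <-] i_reg]] := Xf_regular.
(* The base point is moved within its orbit into the box; regularity of the orbit is unaffected. *)
have [i0 oi0 box] := orbit_box Xf_dom i.
have reg : regular_orbit (orbit i0).
  by move=> j k oj ok; apply: i_reg; apply: orbit_trans; eassumption.
split=> //.
  exact: (double_centralizer Xf_dom hecke_H Ups_action Ups_spec box reg).
split=> // h g.
exact: (Ups_faithful Xf_dom hecke_H Ups_action Ups_spec box reg).
Qed.
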